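(* Let $k$ be a field of characteristic different from $2$ and let $$R=\frac{k[w,x,y,z]}{(w^2,\ wx-y^2,\ wy-xz,\ wz,\ x^2+yz,\ xy,\ z^2)}\,.$$ Then the ideal $xR$ of $R$ is quasi-complete intersection and has infinite CI-dimension (as an $R$-module).
   Context: Local rings are commutative, noetherian, with a unique maximal ideal; the ring $R$ of the statement is a finite-dimensional $k$-algebra, local with maximal ideal generated by the images of $w,x,y,z$. Let $I$ be a proper ideal of a local ring $R$, $S=R/I$, and $E$ the Koszul complex on a finite generating set of $I$. The homology $H_*(E)$ is a graded-commutative $S$-algebra with $H_0(E)=S$, so there is a unique homomorphism of graded $S$-algebras $\lambda^S_*\colon \bigwedge^S_* H_1(E)\to H_*(E)$ that is the identity on $H_1(E)$ in degree $1$. The ideal $I$ is *quasi-complete intersection* if $H_1(E)$ is a free $S$-module and $\lambda^S_*$ is bijective (this does not depend on the choice of generating set). A *quasi-deformation* is a pair $R\to R'\leftarrow Q$ of homomorphisms of local rings with $R\to R'$ (local and) faithfully flat and $R'\leftarrow Q$ surjective with kernel generated by a $Q$-regular sequence. A finitely generated $R$-module $M$ has *finite CI-dimension* if the projective dimension $\operatorname{pd}_Q(R'\otimes_R M)$ is finite for some quasi-deformation $R\to R'\leftarrow Q$; otherwise it has *infinite CI-dimension*. *)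

(* Defs.v *)
From HB Require Import structures.
From mathcomp Require Import all_boot all_order all_algebra.
From mathcomp Require Import boolp finmap.
From mathcomp Require Import mpoly.
From mathcomp Require Import monalg.

Set Implicit Arguments.
Unset Strict Implicit.
Unset Printing Implicit Defensive.

Import GRing.Theory.
Local Open Scope ring_scope.
Local Open Scope quotient_scope.

(* monalg also declares this notation, for a different type. *)
Local Notation "{ 'mpoly' T [ n ] }" := (mpoly n T) : type_scope.

Section Ideals.
Variable R : comNzRingType.

Definition in_span (s : seq R) (a : R) : Prop :=
  exists c : 'I_(size s) -> R, a = \sum_i c i * s`_i.

Definition generates (s : seq R) (I : {pred R}) : Prop :=
  forall a, a \in I <-> in_span s a.

Definition span (s : seq R) : {pred R} := fun a => `[< in_span s a >].

Lemma spanP s a : reflect (in_span s a) (a \in span s).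
Proof. exact: asboolP. Qed.

Lemma span_idealP s a x y :
  x \in span s -> y \in span s -> a * x + y \in span s.
Proof.
move=> /spanP [c ->] /spanP [c' ->]; apply/spanP.
exists (fun i => a * c i + c' i).
rewrite mulr_sumr -big_split /=; apply: eq_bigr => i _.
by rewrite mulrDl mulrA.
Qed.

Lemma span_zmod_closed s : zmod_closed (span s).
Proof.
split=> [|x y xs ys].
  apply/spanP; exists (fun=> 0); rewrite big1 // => i _; exact: mul0r.
by rewrite addrC -mulN1r; apply: span_idealP.
Qed.
HB.instance Definition _ s := GRing.isZmodClosed.Build R (span s)
  (span_zmod_closed s).

Lemma span_idealr_closed s : ~ in_span s 1 -> idealr_closed (span s).
Proof.
move=> s1; split; [exact: rpred0 | exact/spanP |].
by move=> a x y; apply: span_idealP.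
Qed.

(* [idealr R] is the library's type of proper ideals. *)
Definition maximal_ideal (m : idealr R) : Prop :=
  forall J : idealr R, {subset m <= J} -> {subset J <= m}.

(* The improper ideal is generated by 1, so proper ideals suffice. *)
Definition noetherian : Prop :=
  forall I : idealr R, exists s : seq R, generates s I.

Definition local_ring : Prop :=
  noetherian /\
  exists2 m : idealr R, maximal_ideal m
    & forall m' : idealr R, maximal_ideal m' -> m' =i m.

Definition regular_sequence (s : seq R) : Prop :=
  ~ in_span s 1 /\
  forall i a, (i < size s)%N ->
    in_span (take i s) (s`_i * a) -> in_span (take i s) a.

End Ideals.

Definition local_morphism (R R' : comNzRingType) (f : {rmorphism R -> R'}) :=
  forall (m : idealr R) (m' : idealr R'), maximal_ideal m -> maximal_ideal m' ->
  forall a, a \in m -> f a \in m'.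

Definition exact_at (A B : Type) (C : zmodType) (f : A -> B) (g : B -> C) :
  Prop :=
  forall b, g b = 0 <-> exists a, f a = b.

Definition surjective (A B : Type) (f : A -> B) : Prop :=
  forall b, exists a, f a = b.

Section Modules.
Variable R : comNzRingType.

(* {malg R[X]} is the free module of finite formal R-combinations of X. *)
Definition free_module (M : lmodType R) : Prop :=
  exists (X : choiceType) (f : {linear {malg R[X]} -> M}), bijective f.

Definition projective (P : lmodType R) : Prop :=
  forall (M N : lmodType R) (g : {linear M -> N}) (f : {linear P -> N}),
  surjective g -> exists h : {linear P -> M}, forall x, g (h x) = f x.

Definition finite_projective_dimension (M : lmodType R) : Prop :=
  exists (n : nat) (P : nat -> lmodType R)
         (d : forall i, {linear P i.+1 -> P i}) (aug : {linear P 0%N -> M}),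
  [/\ forall i, projective (P i),
      forall i, (n < i)%N -> forall x : P i, x = 0,
      surjective aug,
      exact_at (d 0%N) aug
    & forall i, exact_at (d i.+1) (d i)].

End Modules.

Section IdealModule.
Variables (R : comNzRingType) (I : idealr R).

Definition ideal_pred : {pred R^o} := fun a => (a : R) \in I.

Lemma ideal_pred_closed : submod_closed ideal_pred.
Proof.
split=> [|a x y xI yI]; first exact: (@rpred0 R I).
by apply: (@rpredD R I) => //; apply: idealMr.
Qed.
HB.instance Definition _ := GRing.isSubmodClosed.Build R R^o ideal_pred
  ideal_pred_closed.

Record ideal_module := IdealModule {
  ideal_val : R^o;
  ideal_valP : ideal_val \in ideal_pred
}.
HB.instance Definition _ := [isSub for ideal_val].
HB.instance Definition _ := [Choice of ideal_module by <:].
HB.instance Definition _ :=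
  [SubChoice_isSubLmodule of ideal_module by <:].

End IdealModule.

Definition restr_scalars (Q R : comNzRingType) (f : {rmorphism Q -> R})
  (M : lmodType R) : Type := M.

Section Restriction.
Variables (Q R : comNzRingType) (f : {rmorphism Q -> R}) (M : lmodType R).

HB.instance Definition _ := GRing.Zmodule.on (restr_scalars f M).

Let scale (a : Q) (x : restr_scalars f M) : restr_scalars f M :=
  f a *: (x : M).

Fact restr_scaleA a b x : scale a (scale b x) = scale (a * b) x.
Proof. by rewrite /scale scalerA rmorphM. Qed.
Fact restr_scale1 : left_id 1 scale.
Proof. by move=> x; rewrite /scale rmorph1 scale1r. Qed.
Fact restr_scaleDr : right_distributive scale +%R.
Proof. by move=> a x y; exact: scalerDr. Qed.
Fact restr_scaleDl x : {morph scale^~ x : a b / a + b}.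
Proof. by move=> a b; rewrite /scale rmorphD scalerDl. Qed.
HB.instance Definition _ := GRing.Zmodule_isLmodule.Build Q (restr_scalars f M)
  restr_scaleA restr_scale1 restr_scaleDr restr_scaleDl.

End Restriction.

Section QuotientModule.
Variables (R : pzRingType) (V : lmodType R) (U : submodClosed V).

Definition submod_pred : {pred V} := fun x => x \in U.

Fact submod_pred_zmod_closed : zmod_closed submod_pred.
Proof.
split=> [|x y xU yU]; first exact: (@rpred0 V U).
by rewrite -scaleN1r; apply: (@rpredD V U) => //; apply: (@rpredZ R V U).
Qed.
HB.instance Definition _ := GRing.isZmodClosed.Build V submod_pred
  submod_pred_zmod_closed.

Definition quot_module : Type := Quotient.quot submod_pred.
HB.instance Definition _ := GRing.Zmodule.on quot_module.

Definition qmod (x : V) : quot_module := \pi_(Quotient.quot submod_pred) x.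

Lemma qmod_eq x y : (qmod x = qmod y) <-> (x - y \in U).
Proof.
rewrite (_ : (x - y \in U) = (x - y \in submod_pred)) //.
by rewrite Quotient.idealrBE; split=> [/eqP|/eqP].
Qed.

Lemma qmodK (q : quot_module) : qmod (repr (q : Quotient.quot submod_pred)) = q.
Proof. exact: reprK. Qed.

Lemma qmodD x y : qmod (x + y) = qmod x + qmod y.
Proof. exact: (raddfD \pi_(Quotient.quot submod_pred)). Qed.

Let scale (a : R) (q : quot_module) : quot_module :=
  qmod (a *: repr (q : Quotient.quot submod_pred)).

Lemma quot_scaleE a x : scale a (qmod x) = qmod (a *: x).
Proof. by apply/qmod_eq; rewrite -scalerBr rpredZ //; apply/qmod_eq/qmodK. Qed.

Fact quot_scaleA a b x : scale a (scale b x) = scale (a * b) x.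
Proof. by rewrite -(qmodK x) !quot_scaleE scalerA. Qed.
Fact quot_scale1 : left_id 1 scale.
Proof. by move=> x; rewrite -(qmodK x) quot_scaleE scale1r. Qed.
Fact quot_scaleDr : right_distributive scale +%R.
Proof.
move=> a x y; rewrite -(qmodK x) -(qmodK y).
by rewrite -qmodD !quot_scaleE scalerDr qmodD.
Qed.
Fact quot_scaleDl x : {morph scale^~ x : a b / a + b}.
Proof. by move=> a b; rewrite -(qmodK x) !quot_scaleE scalerDl qmodD. Qed.
HB.instance Definition _ := GRing.Zmodule_isLmodule.Build R quot_module
  quot_scaleA quot_scale1 quot_scaleDr quot_scaleDl.

Fact qmod_linear : linear qmod.
Proof. by move=> a x y; rewrite qmodD -quot_scaleE. Qed.
HB.instance Definition _ := GRing.isLinear.Build R V quot_module _ qmod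
  qmod_linear.

End QuotientModule.

Section LinearSpan.
Variables (R : pzRingType) (V : lmodType R) (G : V -> Prop).

Inductive in_lspan : V -> Prop :=
  | in_lspan0 : in_lspan 0
  | in_lspanD a u v : G u -> in_lspan v -> in_lspan (a *: u + v).

Definition lspan : {pred V} := fun x => `[< in_lspan x >].

Lemma lspanP x : reflect (in_lspan x) (x \in lspan).
Proof. exact: asboolP. Qed.

Lemma lspan_closed : submod_closed lspan.
Proof.
split=> [|a x y /lspanP xs /lspanP ys]; first exact/lspanP/in_lspan0.
apply/lspanP; elim: {x} xs => [|b u v Gu _ IH]; first by rewrite scaler0 add0r.
by rewrite scalerDr -addrA scalerA; apply: in_lspanD.
Qed.
HB.instance Definition _ := GRing.isSubmodClosed.Build R V lspan lspan_closed.

Lemma lspan_sub u : G u -> u \in lspan.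
Proof.
by move=> Gu; apply/lspanP; rewrite -[u]addr0 -[u]scale1r;
  apply: in_lspanD => //; apply: in_lspan0.
Qed.

End LinearSpan.

Section FreeLift.
Variables (R : nzRingType) (X : choiceType) (V : lmodType R) (h : X -> V).

Definition free_lift (g : {malg R[X]}) : V :=
  \sum_(x <- msupp g) mcoeff x g *: h x.

Lemma free_liftEw (d : {fset X}) g :
  (msupp g `<=` d)%fset -> free_lift g = \sum_(x <- d) mcoeff x g *: h x.
Proof.
move=> le; rewrite [LHS](big_fset_incl _ le) => //= x xd /mcoeff_outdom ->.
by rewrite scale0r.
Qed.

Lemma free_lift_linear : linear free_lift.
Proof.
move=> a u v; set w := _ + _; pose d := (msupp u `|` msupp v `|` msupp w)%fset.
have du : (msupp u `<=` d)%fset.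
  by apply/fsubsetP => x; rewrite /d !in_fsetU => ->.
have dv : (msupp v `<=` d)%fset.
  by apply/fsubsetP => x; rewrite /d !in_fsetU => ->; rewrite orbT.
have dw : (msupp w `<=` d)%fset.
  by apply/fsubsetP => x; rewrite /d !in_fsetU => ->; rewrite orbT.
rewrite (free_liftEw du) (free_liftEw dv) (free_liftEw dw).
rewrite scaler_sumr -big_split /=; apply: eq_bigr => x _.
by rewrite mcoeffD mcoeffZ scalerDl scalerA.
Qed.
HB.instance Definition _ := GRing.isLinear.Build R {malg R[X]} V _ free_lift
  free_lift_linear.

Lemma free_liftU x : free_lift << x >> = h x.
Proof.
rewrite (@free_liftEw [fset x]%fset) ?msuppU_le //.
by rewrite big_seq_fset1 mcoeffUU scale1r.
Qed.

End FreeLift.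

Section BaseChange.
Variables (R R' : comNzRingType) (f : {rmorphism R -> R'}).

Section Object.
Variable M : lmodType R.

(* R' (x)_R M is the R'-module on symbols << m >> = 1 (x) m, subject to
   f-semilinearity in m. *)
Inductive tensor_rel : {malg R'[M]} -> Prop :=
  TensorRel a m n :
    tensor_rel (<< a *: m + n >> - (f a *: << m >> + << n >>)).

Definition base_change : Type := quot_module (lspan tensor_rel).
HB.instance Definition _ := GRing.Lmodule.on base_change.

Definition tensor1 (m : M) : base_change := qmod (lspan tensor_rel) << m >>.

Lemma tensor1D a m n : tensor1 (a *: m + n) = f a *: tensor1 m + tensor1 n.
Proof.
rewrite /tensor1 -[f a *: _](linearZZ (qmod (lspan tensor_rel))) -linearD.
by apply/qmod_eq/lspan_sub.
Qed.

Section Lift.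
Variables (N : lmodType R') (h : M -> N).

Definition base_change_lift (t : base_change) : N :=
  free_lift h (repr (t : Quotient.quot (submod_pred (lspan tensor_rel)))).

Hypothesis h_semilinear : forall a m n, h (a *: m + n) = f a *: h m + h n.

Lemma base_change_lift_qmod g :
  base_change_lift (qmod (lspan tensor_rel) g) = free_lift h g.
Proof.
have: qmod (lspan tensor_rel)
    (repr (qmod (lspan tensor_rel) g
           : Quotient.quot (submod_pred (lspan tensor_rel))))
  = qmod (lspan tensor_rel) g by apply: qmodK.
move/qmod_eq/lspanP; rewrite /base_change_lift; set g' := repr _.
move=> H; apply/eqP; rewrite -subr_eq0 -linearB; apply/eqP.
elim: H => [|a _ v [b m n] _ IH]; first exact: linear0.
apply: etrans (free_lift_linear h _ _ _) _; rewrite IH addr0 linearB.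
rewrite [X in _ - X](free_lift_linear h (f b) << m >> << n >>) !free_liftU.
rewrite [X in X - _](etrans (free_liftU h _) (h_semilinear b m n)).
by rewrite subrr scaler0.
Qed.

Lemma base_change_lift_linear : linear base_change_lift.
Proof.
move=> a x y; rewrite -(qmodK x) -(qmodK y) -linearP !base_change_lift_qmod.
exact: linearP.
Qed.

Lemma base_change_lift1 m : base_change_lift (tensor1 m) = h m.
Proof. by rewrite /tensor1 base_change_lift_qmod free_liftU. Qed.

End Lift.
End Object.

Definition base_change_map (M N : lmodType R) (g : {linear M -> N}) :
    base_change M -> base_change N :=
  base_change_lift (fun m => tensor1 (g m)).

Lemma base_change_map_linear (M N : lmodType R) (g : {linear M -> N}) :
  linear (base_change_map g).
Proof.
by apply: base_change_lift_linear => a m n; rewrite linearP tensor1D.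
Qed.
HB.instance Definition _ (M N : lmodType R) (g : {linear M -> N}) :=
  GRing.isLinear.Build R' (base_change M) (base_change N) _
    (base_change_map g) (base_change_map_linear g).

Lemma base_change_map1 (M N : lmodType R) (g : {linear M -> N}) m :
  base_change_map g (tensor1 m) = tensor1 (g m).
Proof.
by apply: base_change_lift1 => a x y; rewrite linearP tensor1D.
Qed.

Definition faithfully_flat : Prop :=
  forall (L M N : lmodType R) (g : {linear L -> M}) (h : {linear M -> N}),
  (forall x, h (g x) = 0) ->
  exact_at g h <->
  exact_at (base_change_map g) (base_change_map h).

End BaseChange.

Definition quasi_deformation (R R' Q : comNzRingType)
    (f : {rmorphism R -> R'}) (q : {rmorphism Q -> R'}) : Prop :=
  [/\ [/\ local_ring R, local_ring R' & local_ring Q],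
      local_morphism f,
      faithfully_flat f,
      surjective q
    & exists2 s : seq Q, regular_sequence s
        & forall a, q a = 0 <-> in_span s a].

Definition finite_CI_dimension (R : comNzRingType) (M : lmodType R) : Prop :=
  exists (R' Q : comNzRingType) (f : {rmorphism R -> R'})
         (q : {rmorphism Q -> R'}),
    quasi_deformation f q /\
    finite_projective_dimension (restr_scalars q (base_change f M)).

Definition infinite_CI_dimension (R : comNzRingType) (M : lmodType R) : Prop :=
  ~ finite_CI_dimension M.

(* The library's [idealr] is one-sided. *)
Record ideal2 (A : nzRingType) := Ideal2 {
  ideal2_pred :> {pred A};
  ideal2_zmod_closed : zmod_closed ideal2_pred;
  ideal2_proper : 1 \notin ideal2_pred;
  ideal2Ml : forall a u, u \in ideal2_pred -> a * u \in ideal2_pred;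
  ideal2Mr : forall a u, u \in ideal2_pred -> u * a \in ideal2_pred
}.

HB.instance Definition _ (A : nzRingType) (J : ideal2 A) :=
  GRing.isZmodClosed.Build A (ideal2_pred J) (ideal2_zmod_closed J).

Section QuotientRing.
Variables (A : nzRingType) (J : ideal2 A).

Definition quot_ring : Type := Quotient.quot (ideal2_pred J).
HB.instance Definition _ := GRing.Zmodule.on quot_ring.

Definition qring (x : A) : quot_ring := \pi_(Quotient.quot (ideal2_pred J)) x.
Definition qrepr (q : quot_ring) : A :=
  repr (q : Quotient.quot (ideal2_pred J)).

Lemma qring_eq x y : (qring x = qring y) <-> (x - y \in ideal2_pred J).
Proof. by rewrite Quotient.idealrBE; split=> [/eqP|/eqP]. Qed.

Lemma qringK q : qring (qrepr q) = q.
Proof. exact: reprK. Qed.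

Fact qring_zmod_morphism : zmod_morphism qring.
Proof. exact: (raddfB \pi_(Quotient.quot (ideal2_pred J))). Qed.
HB.instance Definition _ := GRing.isZmodMorphism.Build A quot_ring qring
  qring_zmod_morphism.

Let mul (p q : quot_ring) : quot_ring := qring (qrepr p * qrepr q).

Fact quot_mulE x y : mul (qring x) (qring y) = qring (x * y).
Proof.
apply/qring_eq; set x' := qrepr _; set y' := qrepr _.
have -> : x' * y' - x * y = (x' - x) * y' + x * (y' - y).
  by rewrite mulrBl mulrBr addrA subrK.
by apply: rpredD; [apply: ideal2Mr | apply: ideal2Ml]; apply/qring_eq/qringK.
Qed.

Fact quot_mulA : associative mul.
Proof.
by move=> x y z; rewrite -[x]qringK -[y]qringK -[z]qringK !quot_mulE mulrA.
Qed.
Fact quot_mul1 : left_id (qring 1) mul.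
Proof. by move=> x; rewrite -[x]qringK quot_mulE mul1r. Qed.
Fact quot_mulr1 : right_id (qring 1) mul.
Proof. by move=> x; rewrite -[x]qringK quot_mulE mulr1. Qed.
Fact quot_mulDl : left_distributive mul +%R.
Proof.
move=> x y z; rewrite -[x]qringK -[y]qringK -[z]qringK.
by rewrite -raddfD !quot_mulE mulrDl raddfD.
Qed.
Fact quot_mulDr : right_distributive mul +%R.
Proof.
move=> x y z; rewrite -[x]qringK -[y]qringK -[z]qringK.
by rewrite -raddfD !quot_mulE mulrDr raddfD.
Qed.
Fact quot_1_neq0 : qring 1 != 0.
Proof.
apply/eqP; rewrite -(raddf0 qring) => /qring_eq; rewrite subr0.
exact/negP/ideal2_proper.
Qed.
HB.instance Definition _ := GRing.Zmodule_isNzRing.Build quot_ring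
  quot_mulA quot_mul1 quot_mulr1 quot_mulDl quot_mulDr quot_1_neq0.

Fact qring_monoid_morphism : monoid_morphism qring.
Proof. by split=> // x y; rewrite -quot_mulE. Qed.
HB.instance Definition _ := GRing.isMonoidMorphism.Build A quot_ring qring
  qring_monoid_morphism.

End QuotientRing.

Section TwoSidedSpan.
Variables (A : nzRingType) (G : A -> Prop).

Inductive in_span2 : A -> Prop :=
  | in_span20 : in_span2 0
  | in_span2D a b u v : G u -> in_span2 v -> in_span2 (a * u * b + v).

Definition span2 : {pred A} := fun x => `[< in_span2 x >].

Lemma span2P x : reflect (in_span2 x) (x \in span2).
Proof. exact: asboolP. Qed.

Lemma span2Ml a u : u \in span2 -> a * u \in span2.
Proof.
move=> /span2P us; apply/span2P.
elim: us => [|b c w v Gw _ IH]; first by rewrite mulr0; apply: in_span20.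
by rewrite mulrDr !mulrA; apply: in_span2D.
Qed.

Lemma span2Mr a u : u \in span2 -> u * a \in span2.
Proof.
move=> /span2P us; apply/span2P.
elim: us => [|b c w v Gw _ IH]; first by rewrite mul0r; apply: in_span20.
by rewrite mulrDl -!mulrA mulrA; apply: in_span2D.
Qed.

Lemma span2_zmod_closed : zmod_closed span2.
Proof.
split=> [|x y xs ys]; first exact/span2P/in_span20.
move: ys => /(span2Ml (-1)); rewrite mulN1r => /span2P ys.
move: xs => /span2P xs; apply/span2P.
elim: {x} xs => [|b c w v Gw _ IH]; first by rewrite add0r.
by rewrite -addrA; apply: in_span2D.
Qed.

Lemma span2_sub u : G u -> u \in span2.
Proof.
move=> Gu; apply/span2P; rewrite -[u]addr0 -[u]mulr1 -[u]mul1r.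
by apply: in_span2D => //; apply: in_span20.
Qed.

End TwoSidedSpan.

Section ExteriorAlgebra.
Variables (S : comNzRingType) (M : lmodType S).

(* {malg S[{fmonom M}]} is the free associative S-algebra on the set M. *)
Definition ext_var (m : M) : {malg S[{fmonom M}]} := << fmu m >>.

Inductive ext_rel : {malg S[{fmonom M}]} -> Prop :=
  | ExtLinear a m n :
      ext_rel (ext_var (a *: m + n) - (a *: ext_var m + ext_var n))
  | ExtSquare m : ext_rel (ext_var m * ext_var m).

Lemma ext_var_aug m : mcoeff mone (ext_var m) = 0.
Proof.
rewrite mcoeffU; case: eqP => // /(congr1 (fun w : {fmonom M} => size w)).
by rewrite fmuE (_ : mone = fmone M) // fmoneE.
Qed.

Lemma ext_proper : 1 \notin span2 ext_rel.
Proof.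
apply/span2P => H; suff: mcoeff mone (1 : {malg S[{fmonom M}]}) = 0.
  by rewrite rmorph1; apply/eqP/oner_neq0.
elim: H => [|a b u v ru _ IH]; first exact: mcoeff0.
rewrite mcoeffD IH addr0 !rmorphM /=.
suff -> : mcoeff mone u = 0 by rewrite mulr0 mul0r.
case: ru => [c m n|m]; last by rewrite rmorphM /= ext_var_aug mul0r.
by rewrite mcoeffB mcoeffD mcoeffZ !ext_var_aug mulr0 addr0 subr0.
Qed.

Definition ext_ideal : ideal2 {malg S[{fmonom M}]} :=
  Ideal2 (span2_zmod_closed ext_rel) ext_proper
    (@span2Ml _ ext_rel) (@span2Mr _ ext_rel).

Definition exterior_algebra : Type := quot_ring ext_ideal.
HB.instance Definition _ := GRing.NzRing.on exterior_algebra.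

Let scale (a : S) (x : exterior_algebra) : exterior_algebra :=
  qring ext_ideal (a *: qrepr x).

Fact ext_scaleE a x : scale a (qring ext_ideal x) = qring ext_ideal (a *: x).
Proof.
apply/qring_eq; rewrite -scalerBr -mul_malgC; apply: ideal2Ml.
exact/qring_eq/qringK.
Qed.
Fact ext_scaleA a b x : scale a (scale b x) = scale (a * b) x.
Proof. by rewrite -(qringK x) !ext_scaleE scalerA. Qed.
Fact ext_scale1 : left_id 1 scale.
Proof. by move=> x; rewrite -(qringK x) ext_scaleE scale1r. Qed.
Fact ext_scaleDr : right_distributive scale +%R.
Proof.
move=> a x y; rewrite -(qringK x) -(qringK y).
by rewrite -raddfD !ext_scaleE scalerDr raddfD.
Qed.
Fact ext_scaleDl x : {morph scale^~ x : a b / a + b}.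
Proof. by move=> a b; rewrite -(qringK x) !ext_scaleE scalerDl raddfD. Qed.
HB.instance Definition _ := GRing.Zmodule_isLmodule.Build S exterior_algebra
  ext_scaleA ext_scale1 ext_scaleDr ext_scaleDl.

Fact ext_scaleAl (a : S) (x y : exterior_algebra) :
  a *: (x * y) = (a *: x) * y.
Proof.
rewrite -(qringK x) -(qringK y) -[LHS]/(scale _ _) -[a *: _]/(scale _ _).
rewrite ext_scaleE -[X in scale _ X](rmorphM (qring ext_ideal)) ext_scaleE.
by rewrite scalerAl rmorphM.
Qed.
HB.instance Definition _ := GRing.Lmodule_isLalgebra.Build S exterior_algebra
  ext_scaleAl.

Definition ext_gen (m : M) : exterior_algebra := qring ext_ideal (ext_var m).

Lemma ext_gen_linear : linear ext_gen.
Proof.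
move=> a m n.
have -> : a *: ext_gen m = qring ext_ideal (a *: ext_var m).
  exact: ext_scaleE.
rewrite -[RHS](raddfD (qring ext_ideal)).
exact/qring_eq/span2_sub/ExtLinear.
Qed.

Lemma ext_gen_sqr m : ext_gen m * ext_gen m = 0.
Proof.
rewrite -[LHS]rmorphM -(raddf0 (qring ext_ideal)).
by apply/qring_eq; rewrite subr0; apply/span2_sub/ExtSquare.
Qed.

End ExteriorAlgebra.

(* Differential graded algebras, with [dga_bar x = (-1)^n x] on elements [x]
   of degree [n], so that [dga_leibniz] is the usual signed Leibniz rule. *)
Record dga (R : comNzRingType) := Dga {
  dga_alg :> algType R;
  dga_deg : nat -> dga_alg -> Prop;
  dga_bar : dga_alg -> dga_alg;
  dga_d : dga_alg -> dga_alg;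
  dga_deg_closed : forall n a x y,
    dga_deg n x -> dga_deg n y -> dga_deg n (a *: x + y);
  dga_deg0 : forall n, dga_deg n 0;
  dga_bar_linear : linear dga_bar;
  dga_bar_mul : monoid_morphism dga_bar;
  dga_barK : involutive dga_bar;
  dga_bar_deg : forall n x, dga_deg n x -> dga_bar x = (-1) ^+ n *: x;
  dga_d_linear : linear dga_d;
  dga_bar_d : forall x, dga_bar (dga_d x) = - dga_d (dga_bar x);
  dga_dd : forall x, dga_d (dga_d x) = 0;
  dga_leibniz : forall x y,
    dga_d (x * y) = dga_d x * y + dga_bar x * dga_d y
}.

HB.instance Definition _ (R : comNzRingType) (X : dga R) :=
  GRing.isLinear.Build R X X _ (@dga_bar R X) (@dga_bar_linear R X).
HB.instance Definition _ (R : comNzRingType) (X : dga R) :=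
  GRing.isMonoidMorphism.Build X X (@dga_bar R X) (@dga_bar_mul R X).
HB.instance Definition _ (R : comNzRingType) (X : dga R) :=
  GRing.isLinear.Build R X X _ (@dga_d R X) (@dga_d_linear R X).

Lemma dga_barZ (R : comNzRingType) (X : dga R) (c : R) (x : X) :
  dga_bar (c *: x) = c *: dga_bar x.
Proof. by rewrite -[c *: x]addr0 dga_bar_linear raddf0 addr0. Qed.

Lemma dga_dZ (R : comNzRingType) (X : dga R) (c : R) (x : X) :
  dga_d (c *: x) = c *: dga_d x.
Proof. by rewrite -[c *: x]addr0 dga_d_linear raddf0 addr0. Qed.

Lemma dga_barN (R : comNzRingType) (X : dga R) (x : X) :
  dga_bar (- x) = - dga_bar x.
Proof. exact: raddfN. Qed.

Lemma dga_dN (R : comNzRingType) (X : dga R) (x : X) :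
  dga_d (- x) = - dga_d x.
Proof. exact: raddfN. Qed.

Lemma dga_barD (R : comNzRingType) (X : dga R) (x y : X) :
  dga_bar (x + y) = dga_bar x + dga_bar y.
Proof. exact: raddfD. Qed.

Lemma dga_dD (R : comNzRingType) (X : dga R) (x y : X) :
  dga_d (x + y) = dga_d x + dga_d y.
Proof. exact: raddfD. Qed.

Lemma dga_d1 (R : comNzRingType) (X : dga R) : dga_d (1 : X) = 0.
Proof.
have := dga_leibniz (1 : X) 1; rewrite rmorph1 !mulr1 mul1r => /eqP.
by rewrite -subr_eq subrr eq_sym => /eqP.
Qed.

#[local] Obligation Tactic := idtac.

Section DgaBase.
Variable R : comNzRingType.

Definition base_deg (n : nat) (x : R^o) : Prop := n = 0%N \/ x = 0.

Program Definition dga_base : dga R :=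
  @Dga R R^o base_deg id (fun=> 0) _ _ _ _ _ _ _ _ _ _.
Next Obligation.
move=> n a x y [->|->]; first by left.
by case=> [->|->]; [left | right; rewrite scaler0 addr0].
Qed.
Next Obligation. by move=> n; right. Qed.
Next Obligation. by []. Qed.
Next Obligation. by split. Qed.
Next Obligation. by []. Qed.
Next Obligation.
by move=> n x [->|->]; rewrite ?expr0 ?scale1r ?scaler0.
Qed.
Next Obligation. by move=> a x y; rewrite scaler0 addr0. Qed.
Next Obligation. by move=> x; rewrite oppr0. Qed.
Next Obligation. by []. Qed.
Next Obligation. by move=> x y; rewrite mul0r mulr0 addr0. Qed.

End DgaBase.

(* [adjoin a X] is X (x) K(a), where K(a) has basis 1, e with e of degree 1
   and d e = a; the pair (u, v) stands for u + e v. *)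
Definition adjoin (R : comNzRingType) (a : R) (X : dga R) : Type :=
  (X * X)%type.

Section Adjoin.
Variables (R : comNzRingType) (a : R) (X : dga R).
Local Notation T := (adjoin a X).
Local Notation bar := (@dga_bar R X).
Local Notation d := (@dga_d R X).

HB.instance Definition _ := GRing.Lmodule.copy T (X * X)%type.

Let one : T := (1, 0).
Let mul (x y : T) : T := (x.1 * y.1, x.2 * y.1 + bar x.1 * y.2).

Lemma pair_ext (U V : Type) (x y : U * V) : x.1 = y.1 -> x.2 = y.2 -> x = y.
Proof. by case: x y => [? ?] [? ?] /= -> ->. Qed.

Fact adjoin_mulA : associative mul.
Proof.
move=> x y z; apply: pair_ext; rewrite /= ?mulrA //.
by rewrite rmorphM mulrDr mulrDl !mulrA addrA.
Qed.
Fact adjoin_mul1 : left_id one mul.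
Proof.
by move=> x; apply: pair_ext; rewrite /= ?mul1r // mul0r add0r rmorph1 mul1r.
Qed.
Fact adjoin_mulr1 : right_id one mul.
Proof. by move=> x; apply: pair_ext; rewrite /= ?mulr1 // mulr0 addr0. Qed.
Fact adjoin_mulDl : left_distributive mul +%R.
Proof.
move=> x y z; apply: pair_ext; rewrite /= ?mulrDl //.
by rewrite raddfD mulrDl addrACA.
Qed.
Fact adjoin_mulDr : right_distributive mul +%R.
Proof.
by move=> x y z; apply: pair_ext; rewrite /= ?mulrDr // addrACA.
Qed.
Fact adjoin_1_neq0 : one != 0.
Proof. by apply/eqP => -[] /eqP; rewrite oner_eq0. Qed.
HB.instance Definition _ := GRing.Zmodule_isNzRing.Build T
  adjoin_mulA adjoin_mul1 adjoin_mulr1 adjoin_mulDl adjoin_mulDr adjoin_1_neq0.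

Fact adjoin_scaleAl (c : R) (x y : T) : c *: (x * y) = (c *: x : T) * y.
Proof.
apply: pair_ext; rewrite /= ?scalerAl //.
by rewrite scalerDr dga_barZ !scalerAl.
Qed.
HB.instance Definition _ := GRing.Lmodule_isLalgebra.Build R T adjoin_scaleAl.

Fact adjoin_scaleAr (c : R) (x y : T) : c *: (x * y) = x * (c *: y : T).
Proof.
by apply: pair_ext; rewrite /= ?scalerAr // scalerDr !scalerAr.
Qed.
HB.instance Definition _ := GRing.Lalgebra_isAlgebra.Build R T adjoin_scaleAr.

Definition adjoin_deg (n : nat) (x : T) : Prop :=
  dga_deg n x.1 /\ (if n is m.+1 then dga_deg m x.2 else x.2 = 0).
Definition adjoin_bar (x : T) : T := (bar x.1, - bar x.2).
Definition adjoin_d (x : T) : T := (d x.1 + a *: x.2, - d x.2).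

Program Definition dga_adjoin : dga R :=
  @Dga R T adjoin_deg adjoin_bar adjoin_d _ _ _ _ _ _ _ _ _ _.
Next Obligation.
move=> n c x y [x1 x2] [y1 y2]; split; first exact: dga_deg_closed.
case: n x1 x2 y1 y2 => [|n] _ x2 _ y2; last exact: dga_deg_closed.
by rewrite /= x2 y2 scaler0 addr0.
Qed.
Next Obligation.
by move=> n; split; [|case: n => [|n]]; try exact: dga_deg0.
Qed.
Next Obligation.
move=> c x y; apply: pair_ext; rewrite /= linearP //.
by rewrite opprD scalerN.
Qed.
Next Obligation.
split; first by apply: pair_ext; rewrite /= ?rmorph1 // raddf0 oppr0.
move=> x y; apply: pair_ext; rewrite /= ?rmorphM //.
by rewrite rmorphD !rmorphM /= opprD mulNr mulrN.
Qed.
Next Obligation.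
move=> x; apply: pair_ext; rewrite /= ?dga_barK //.
by rewrite raddfN opprK; apply: dga_barK.
Qed.
Next Obligation.
move=> n x [x1 x2]; apply: pair_ext => /=; first exact: dga_bar_deg.
case: n x1 x2 => [|n] _ x2; first by rewrite x2 raddf0 oppr0 scaler0.
by rewrite (dga_bar_deg x2) exprS mulN1r scaleNr.
Qed.
Next Obligation.
move=> c x y; apply: pair_ext; rewrite /= linearP.
  by rewrite !scalerDr !scalerA [a * c]mulrC addrACA.
by rewrite opprD scalerN.
Qed.
Next Obligation.
move=> x; apply: pair_ext => /=.
  2: by rewrite dga_barN dga_dN !opprK dga_bar_d.
by rewrite dga_barD dga_barZ dga_bar_d opprD scalerN opprK.
Qed.
Next Obligation.
move=> x; apply: pair_ext => /=; last by rewrite dga_dN dga_dd !oppr0.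
by rewrite dga_dD dga_dd add0r dga_dZ scalerN subrr.
Qed.
Next Obligation.
move=> x y; apply: pair_ext => /=.
  rewrite dga_leibniz mulrDl mulrDr scalerDr -!scalerAl -!scalerAr.
  by rewrite addrACA.
rewrite dga_dD !dga_leibniz dga_barD dga_barZ dga_bar_d.
rewrite !mulrDl !mulrDr !mulNr mulrN -scalerAl -scalerAr !opprD.
by rewrite [RHS](AC (1*2*(2*1)) ((1*4)*(2*6)*(3*5)))/= subrr addr0.
Qed.

End Adjoin.

Fixpoint koszul (R : comNzRingType) (s : seq R) : dga R :=
  if s is a :: s' then dga_adjoin a (koszul s') else dga_base R.

Section KoszulTheory.
Variable R : comNzRingType.

Lemma koszul_homotopy (s : seq R) (a : R) :
  in_span s a -> exists e : koszul s, dga_d e = a%:A.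
Proof.
elim: s a => [|b s IH] a [c].
  by rewrite big_ord0 => ->; exists 0; rewrite raddf0 scale0r.
rewrite big_ord_recl /= => ->.
have [|e de] := IH (\sum_(i < size s) c (lift ord0 i) * s`_i).
  by exists (fun i => c (lift ord0 i)).
exists ((e, (c ord0)%:A) : dga_adjoin b (koszul s)).
apply: pair_ext => /=; last first.
  by rewrite dga_dZ dga_d1 scaler0 oppr0 scaler0.
by rewrite de scalerA mulrC scalerDl addrC.
Qed.

Lemma koszul_aug (s : seq R) : exists eps : koszul s -> R,
  [/\ linear_for *%R eps, eps 1 = 1 & forall x, in_span s (eps (dga_d x))].
Proof.
elim: s => [|b s [eps [epsL eps1 epsd]]].
  exists id; split=> // x.
  by exists (fun=> 0); rewrite big_ord0.
exists (fun x => eps x.1); split=> [a x y /=||x /=] //; first exact: epsL.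
have [c cE] := epsd x.1.
have -> : eps (dga_d x.1 + b *: x.2) = b * eps x.2 + eps (dga_d x.1).
  by rewrite addrC epsL.
rewrite cE.
exists (fun i => if unlift ord0 i is Some j then c j else eps x.2).
rewrite big_ord_recl /= unlift_none mulrC; congr (_ + _).
by apply: eq_bigr => i _; rewrite liftK.
Qed.

End KoszulTheory.

Section Cycles.
Variables (R : comNzRingType) (X : dga R).

Definition cycle_pred : {pred X} := fun x => dga_d x == 0.

Fact cycle_subalg_closed : subalg_closed cycle_pred.
Proof.
split=> [|a x y /eqP xZ /eqP yZ|x y /eqP xZ /eqP yZ].
- by rewrite unfold_in dga_d1.
- by rewrite unfold_in dga_dD dga_dZ xZ yZ scaler0 addr0.
- by rewrite unfold_in dga_leibniz xZ yZ mul0r mulr0 addr0.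
Qed.
HB.instance Definition _ := GRing.isSubalgClosed.Build R X cycle_pred
  cycle_subalg_closed.

Record cycles := Cycle { cycle_val : X; cycleP : cycle_val \in cycle_pred }.
HB.instance Definition _ := [isSub for cycle_val].
HB.instance Definition _ := [Choice of cycles by <:].
HB.instance Definition _ := [SubChoice_isSubLalgebra of cycles by <:].

Definition boundaries : {pred cycles} :=
  fun z => `[< exists y : X, dga_d y = cycle_val z >].

Lemma boundariesP z :
  reflect (exists y : X, dga_d y = cycle_val z) (z \in boundaries).
Proof. exact: asboolP. Qed.

Lemma dga_d_cycle (z : cycles) : dga_d (cycle_val z) = 0.
Proof. exact/eqP/cycleP. Qed.

Fact boundaries_zmod_closed : zmod_closed boundaries.
Proof.
split=> [|z z' /boundariesP [y dy] /boundariesP [y' dy']].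
  by apply/boundariesP; exists 0; rewrite raddf0.
by apply/boundariesP; exists (y - y'); rewrite dga_dD dga_dN dy dy'.
Qed.

Fact boundariesMl z u : u \in boundaries -> z * u \in boundaries.
Proof.
move=> /boundariesP [y dy]; apply/boundariesP.
exists (dga_bar (cycle_val z) * y).
rewrite dga_leibniz dga_barK dy -[dga_d (dga_bar _)]opprK -dga_bar_d.
by rewrite dga_d_cycle raddf0 oppr0 mul0r add0r.
Qed.

Fact boundariesMr z u : u \in boundaries -> u * z \in boundaries.
Proof.
move=> /boundariesP [y dy]; apply/boundariesP; exists (y * cycle_val z).
by rewrite dga_leibniz dy dga_d_cycle mulr0 addr0.
Qed.

End Cycles.

Section KoszulHomology.
Variables (R : comNzRingType) (I : idealr R) (s : seq R) (sI : generates s I).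
Local Notation E := (koszul s).
Local Notation S := {ideal_quot I}.

Fact boundaries_proper : 1 \notin @boundaries R E.
Proof.
apply/boundariesP => -[y dy]; have [eps [_ eps1 epsd]] := koszul_aug s.
by have /sI := epsd y; rewrite dy eps1 idealr1.
Qed.

Definition boundary_ideal : ideal2 (cycles E) :=
  Ideal2 (@boundaries_zmod_closed R E) boundaries_proper
    (@boundariesMl R E) (@boundariesMr R E).

(* H_*(E) as an algebra over S = R/I; [boundariesZ] gives the well-definedness
   of the action of S. *)
Definition koszul_homology : Type := quot_ring boundary_ideal.
Local Notation H := koszul_homology.
HB.instance Definition _ := GRing.NzRing.on H.

Definition hclass (z : cycles E) : H := qring boundary_ideal z.

Lemma hclass_eq z z' : hclass z = hclass z' <-> z - z' \in @boundaries R E.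
Proof. exact: (qring_eq boundary_ideal). Qed.

Lemma hclassK (h : H) : hclass (qrepr h) = h.
Proof. exact: qringK. Qed.

Lemma hclassD z z' : hclass (z + z') = hclass z + hclass z'.
Proof. exact: (raddfD (qring boundary_ideal)). Qed.

Lemma hclassM z z' : hclass (z * z') = hclass z * hclass z'.
Proof. exact: (rmorphM (qring boundary_ideal)). Qed.

Lemma boundariesZ (a : R) (z : cycles E) :
  (a \in I) || (z \in @boundaries R E) -> a *: z \in @boundaries R E.
Proof.
case/orP=> [/sI/koszul_homotopy [e de]|/boundariesP [y dy]]; apply/boundariesP.
  exists (e * cycle_val z).
  by rewrite dga_leibniz de dga_d_cycle mulr0 addr0 -scalerAl mul1r.
by exists (a *: y); rewrite dga_dZ dy.
Qed.

Let scale (a : S) (h : H) : H := hclass (repr a *: qrepr h).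

Fact hscaleE (a : R) (z : cycles E) :
  scale (\pi_S a) (hclass z) = hclass (a *: z).
Proof.
apply/hclass_eq; set a' := repr _; set z' := qrepr _.
have -> : a' *: z' - a *: z = (a' - a) *: z' + a *: (z' - z).
  by rewrite scalerBl scalerBr addrA subrK.
apply: (@rpredD _ (ideal2_pred boundary_ideal)); apply: boundariesZ.
  by rewrite Quotient.idealrBE reprK eqxx.
by apply/orP; right; apply/hclass_eq/hclassK.
Qed.
Fact hscaleA a b h : scale a (scale b h) = scale (a * b) h.
Proof.
rewrite -(hclassK h) -[a]reprK -[b]reprK; move: (qrepr h) => z.
by rewrite [X in scale _ X]hscaleE hscaleE -rmorphM hscaleE scalerA.
Qed.
Fact hscale1 : left_id 1 scale.
Proof.
by move=> h; rewrite -(hclassK h) -(rmorph1 \pi_S) hscaleE scale1r.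
Qed.
Fact hscaleDr : right_distributive scale +%R.
Proof.
move=> a x y; rewrite -(hclassK x) -(hclassK y) -[a]reprK.
by rewrite -hclassD !hscaleE scalerDr hclassD.
Qed.
Fact hscaleDl h : {morph scale^~ h : a b / a + b}.
Proof.
move=> a b; rewrite -(hclassK h) -[a]reprK -[b]reprK -raddfD !hscaleE.
by rewrite scalerDl hclassD.
Qed.
HB.instance Definition _ := GRing.Zmodule_isLmodule.Build S H
  hscaleA hscale1 hscaleDr hscaleDl.

Lemma hclassZ (a : R) (z : cycles E) :
  (\pi_S a : S) *: hclass z = hclass (a *: z).
Proof. exact: hscaleE. Qed.

Fact hscaleAl (a : S) (x y : H) : a *: (x * y) = (a *: x : H) * y.
Proof.
rewrite -(hclassK x) -(hclassK y) -[a]reprK.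
move: (repr a) (qrepr x) (qrepr y) => {}a {}x {}y.
by rewrite -hclassM !hclassZ -hclassM scalerAl.
Qed.
HB.instance Definition _ := GRing.Lmodule_isLalgebra.Build S H hscaleAl.

Definition hdeg (n : nat) : {pred H} :=
  fun h => `[< exists2 z : cycles E, dga_deg n (cycle_val z) & h = hclass z >].

Fact hdeg_submod_closed n : submod_closed (hdeg n).
Proof.
split=> [|a x y /asboolP [z zn ->] /asboolP [z' zn' ->]]; apply/asboolP.
  by exists 0; [exact: dga_deg0 | exact/esym/(raddf0 (qring boundary_ideal))].
exists (repr a *: z + z'); first exact: dga_deg_closed.
by rewrite hclassD -hclassZ reprK.
Qed.
HB.instance Definition _ n := GRing.isSubmodClosed.Build S H (hdeg n)
  (hdeg_submod_closed n).

Record homology_deg (n : nat) :=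
  HomologyDeg { homology_val : H; homology_valP : homology_val \in hdeg n }.
HB.instance Definition _ n := [isSub for @homology_val n].
HB.instance Definition _ n := [Choice of homology_deg n by <:].
HB.instance Definition _ n := [SubChoice_isSubLmodule of homology_deg n by <:].

End KoszulHomology.

(* The map lam is the unique S-algebra homomorphism from the exterior algebra
   on H_1(E) to H_*(E) that restricts to the inclusion of H_1(E). *)
Definition quasi_complete_intersection (R : comNzRingType) (I : idealr R) :
    Prop :=
  local_ring R /\
  exists (s : seq R) (sI : generates s I),
    free_module (homology_deg sI 1%N) /\
    exists lam : {lrmorphism exterior_algebra (homology_deg sI 1%N)
                              -> koszul_homology sI},
      (forall h, lam (ext_gen h) = homology_val h) /\ bijective lam.

Section Example.
Variable k : fieldType.
Local Notation P := {mpoly k[4]}.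
Local Notation w := ('X_(inord 0%N) : P).
Local Notation x := ('X_(inord 1%N) : P).
Local Notation y := ('X_(inord 2%N) : P).
Local Notation z := ('X_(inord 3%N) : P).

Definition relations : seq P :=
  [:: w ^+ 2; w * x - y ^+ 2; w * y - x * z; w * z; x ^+ 2 + y * z; x * y;
      z ^+ 2].

Definition relation_ideal : {pred P} := span relations.

Lemma relation_ideal_eval0 (p : P) :
  p \in relation_ideal -> meval (fun=> 0) p = 0.
Proof.
case/spanP=> c ->; rewrite raddf_sum /= big1 // => i _; rewrite mevalM.
suff /allP H : all (fun q => meval (fun=> 0) q == 0) relations.
  by rewrite (eqP (H _ (@mem_nth _ 0 relations i (ltn_ord i)))) mulr0.
by rewrite /relations /= !(mevalB, mevalD, mevalM, mevalXU, expr2)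
  !(mulr0, addr0, subr0) eqxx.
Qed.

Fact relation_ideal_closed : idealr_closed relation_ideal.
Proof.
apply: span_idealr_closed => /spanP/relation_ideal_eval0 /eqP.
by rewrite meval1 oner_eq0.
Qed.
HB.instance Definition _ := isIdealr.Build P relation_ideal
  relation_ideal_closed.

Definition exampleR : comNzRingType := {ideal_quot (relation_ideal : idealr P)}.

Definition class_x : exampleR := \pi_exampleR x.

Definition x_ideal : {pred exampleR} := span [:: class_x].

Fact x_ideal_closed : idealr_closed x_ideal.
Proof.
apply: span_idealr_closed => -[c]; rewrite big_ord1 /= -[c _]reprK.
rewrite -rmorphM -(rmorph1 \pi_exampleR) => /eqP.
rewrite -Quotient.idealrBE => /relation_ideal_eval0 /eqP.
by rewrite mevalB mevalM meval1 mevalXU mulr0 subr0 oner_eq0.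
Qed.
HB.instance Definition _ := isIdealr.Build exampleR x_ideal x_ideal_closed.

End Example.

Arguments x_ideal : clear implicits.

(* Main.v *)
(* Let m = (w, x, y, z). Then m^3 = 0 and 1, w, x, y, z, wx = y^2, wy = xz,
   x^2 = -yz is a basis of R, so ann x = (y) and ann y = (x). The Koszul complex
   E on x thus has H_1(E) = ann x = yR, free of rank one over R/x, and
   H_*(E) = H_0(E) + H_1(E) is the exterior algebra on H_1(E).

   Consider a quasi-deformation R -> R' <- Q, let the kernel J of Q -> R' be
   generated by the regular sequence s, and lift w, x, y, z to W, X, Y, Z in Q.
   The syzygies
     Z (W^2) = W (WZ),
     Y (XY) + Y (WZ) + X (WX - Y^2) = W (X^2 + YZ),
   read in J/J^2, which is free over R', show by flatness that XY = sum a_i s_i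
   where the a_i map to the maximal ideal m' of R'. Now R' (x) xR = R'/y has
   over Q the Tate resolution obtained from the Koszul complex on Y, s by
   adjoining a divided power variable of degree 2 whose boundary is the cycle
   X e_Y - sum a_i e_i. All entries of its differential act as zero on R'/m',
   so Ext^i_Q(R'/y, R'/m') is nonzero for infinitely many i. *)
From HB Require Import structures.
From mathcomp Require Import all_boot all_order all_algebra.
From mathcomp Require Import boolp ring finmap mpoly.
Require Import Defs.

Set Implicit Arguments.
Unset Strict Implicit.
Unset Printing Implicit Defensive.
Import GRing.Theory.
Local Open Scope ring_scope.
Local Open Scope quotient_scope.

(** * Comparison of projective resolutions *)

Section LinearMaps.
Variable Q : nzRingType.

Definition mklin (A B : lmodType Q) (f : A -> B) (fL : linear f) :
    {linear A -> B} :=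
  HB.pack f (GRing.isLinear.Build Q A B *:%R f fL).

Variables A B C : lmodType Q.

Fact lpair_subproof (f : {linear A -> B}) (g : {linear A -> C}) :
  linear (fun x => (f x, g x)).
Proof. by move=> a x y; rewrite !linearP. Qed.
Definition lpair f g : {linear A -> (B * C)%type} := mklin (lpair_subproof f g).

Fact inl_subproof : linear (fun x : A => (x, 0 : B)).
Proof. by move=> a x y; apply: pair_ext; rewrite //= scaler0 addr0. Qed.
Definition lininl : {linear A -> (A * B)%type} := mklin inl_subproof.
Fact inr_subproof : linear (fun y : B => (0 : A, y)).
Proof. by move=> a x y; apply: pair_ext; rewrite //= scaler0 addr0. Qed.
Definition lininr : {linear B -> (A * B)%type} := mklin inr_subproof.

Fact act_subproof (v : A) : linear (fun c : Q^o => (c : Q) *: v).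
Proof. by move=> a x y; rewrite scalerDl scalerA. Qed.
Definition act (v : A) : {linear Q^o -> A} := mklin (act_subproof v).

End LinearMaps.

Section Image.
Variables (Q : nzRingType) (A B : lmodType Q) (g : {linear A -> B}).

Definition image_pred : {pred B} := fun b => `[< exists a, g a = b >].
Fact image_closed : submod_closed image_pred.
Proof.
split=> [|c x y /asboolP [a <-] /asboolP [a' <-]]; apply/asboolP.
  by exists 0; rewrite linear0.
by exists (c *: a + a'); rewrite linearP.
Qed.
HB.instance Definition _ := GRing.isSubmodClosed.Build Q B image_pred
  image_closed.
Record image_module :=
  ImageModule { image_val : B; image_valP : image_val \in image_pred }.
HB.instance Definition _ := [isSub for image_val].
HB.instance Definition _ := [Choice of image_module by <:].
HB.instance Definition _ := [SubChoice_isSubLmodule of image_module by <:].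

End Image.

Section Projective.
Variable Q : comNzRingType.

(** [projective] lifts along surjections only, so [g] and [f] are corestricted to [image_module g],
    where [g] becomes onto. *)
Lemma projective_lift (P A B : lmodType Q) (g : {linear A -> B})
    (f : {linear P -> B}) :
  projective P -> (forall p, exists a, g a = f p) ->
  exists h : {linear P -> A}, forall p, g (h p) = f p.
Proof.
move=> Pproj fg.
have gP a : g a \in image_pred g by apply/asboolP; exists a.
have fP p : f p \in image_pred g by apply/asboolP.
have gL : linear (fun a => ImageModule (gP a)).
  by move=> c x y; apply/val_inj; rewrite /= linearP.
have fL : linear (fun p => ImageModule (fP p)).
  by move=> c x y; apply/val_inj; rewrite /= linearP.
have [|h hE] := Pproj _ _ (mklin gL) (mklin fL).
  case=> b bP; have /asboolP [a ab] := bP.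
  by exists a; apply/val_inj; rewrite /= ab.
by exists h => p; have /(congr1 val) := hE p.
Qed.

Lemma projective_regular : projective (Q^o : lmodType Q).
Proof.
move=> M N g f surj; have [m gm] := surj (f 1).
by exists (act m) => c; rewrite linearZ /= gm -linearZ /= [_ *: _]mulr1.
Qed.

Lemma projective_trivial (P : lmodType Q) :
  (forall x : P, x = 0) -> projective P.
Proof.
move=> P0 M N g f _; have zL : linear (fun _ : P => 0 : M).
  by move=> a x y /=; rewrite scaler0 addr0.
by exists (mklin zL) => x; rewrite (P0 x) !linear0.
Qed.

Lemma projective_pair (P P' : lmodType Q) :
  projective P -> projective P' -> projective (P * P')%type.
Proof.
move=> pP pP' M N g f surj.
have [h hE] := pP M N g (f \o lininl P P') surj.
have [h' hE'] := pP' M N g (f \o lininr P P') surj.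
exists ((h \o fst) \+ (h' \o snd)) => -[x y] /=.
rewrite linearD hE hE' /= -linearD; congr (f _).
by apply: pair_ext; rewrite /= ?addr0 ?add0r.
Qed.

Section Comparison.
Variables (M : lmodType Q) (P : nat -> lmodType Q)
  (dP : forall i, {linear P i.+1 -> P i}) (augP : {linear P 0%N -> M})
  (T : nat -> lmodType Q)
  (dT : forall i, {linear T i.+1 -> T i}) (augT : {linear T 0%N -> M}).
Hypotheses (P_proj : forall i, projective (P i))
  (T_proj : forall i, projective (T i))
  (augP_surj : surjective augP) (augT_surj : surjective augT)
  (P_exact0 : exact_at (dP 0%N) augP) (T_exact0 : exact_at (dT 0%N) augT)
  (P_exact : forall i, exact_at (dP i.+1) (dP i))
  (T_exact : forall i, exact_at (dT i.+1) (dT i)).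

(* [r] stands for [s_(i-1) \o dT], where the [s_i] form a homotopy between the
   identity and [psi \o phi]; this makes sense for [i = 0] too. *)
Definition comparison i (phi : {linear T i -> P i}) (psi : {linear P i -> T i})
    (r : {linear T i -> T i}) :=
  [/\ forall x, exists y, dP i y = phi (dT i x),
      forall y, exists x, dT i x = psi (dP i y),
      forall x, exists y, dT i y = x - psi (phi x) - r x
    & forall x, r (dT i x) = 0].

Lemma dPdP i x : dP i (dP i.+1 x) = 0.
Proof. by apply/P_exact; exists x. Qed.

Lemma dTdT i x : dT i (dT i.+1 x) = 0.
Proof. by apply/T_exact; exists x. Qed.

Lemma comparison0 : exists phi psi r, @comparison 0 phi psi r.
Proof.
have [phi phiE] := T_proj augT augP_surj.
have [psi psiE] := P_proj augP augT_surj.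
exists phi, psi, (\0 : {linear _ -> _}); split=> //= x.
- by apply/P_exact0; rewrite phiE; apply/T_exact0; exists x.
- by apply/T_exact0; rewrite psiE; apply/P_exact0; exists x.
- by apply/T_exact0; rewrite subr0 linearB psiE phiE subrr.
Qed.

(** One lifting each yields [phi'], [psi'] and the homotopy [s]; then
    [x - psi' (phi' x) - s (dT i x)] is a cycle of [T], hence a boundary, which restores the
    invariant one degree higher. *)
Lemma comparisonS i phi psi r : @comparison i phi psi r ->
  exists phi' psi' (s : {linear T i -> T i.+1}),
    @comparison i.+1 phi' psi' (s \o dT i).
Proof.
case=> phiL psiL sL rd.
have [phi' phiE] := projective_lift (f := phi \o dT i) (@T_proj i.+1) phiL.
have [psi' psiE] := projective_lift (f := psi \o dP i) (@P_proj i.+1) psiL.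
have fL : linear (fun x => x - psi (phi x) - r x).
  move=> a x y /=; rewrite (linearP phi) (linearP psi) (linearP r) !scalerBr.
  by rewrite !opprD [a *: x + y + _]addrACA [LHS]addrACA.
have [s sE] := projective_lift (f := mklin fL) (@T_proj i) sL.
exists phi', psi', s; split=> x /=.
- by apply/P_exact; rewrite phiE /= dTdT linear0.
- by apply/T_exact; rewrite psiE /= dPdP linear0.
- apply/T_exact; rewrite !linearB psiE /= phiE /= sE /= rd subr0.
  by rewrite opprB addrA subrK subrr.
- by rewrite dTdT linear0.
Qed.

Lemma comparison_exists i : exists phi psi r, @comparison i phi psi r.
Proof.
elim: i => [|i [phi [psi [r /comparisonS]]]]; first exact: comparison0.
by move=> [phi' [psi' [s c]]]; exists phi', psi', (s \o dT i).
Qed.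

(** This is [Ext^(i+1)(M, V) = 0]. As [P i.+1] is zero, so is [phi']; hence [x - s (dT i x)] is a
    boundary and the cocycle [g] agrees on [x] with [g \o s] on [dT i x]. *)
Lemma cocycle_coboundary i (V : lmodType Q) (g : {linear T i.+1 -> V}) :
  (forall x : P i.+1, x = 0) -> (forall x, g (dT i.+1 x) = 0) ->
  exists h : {linear T i -> V}, forall x, g x = h (dT i x).
Proof.
move=> P0 gd; have [phi [psi [r /comparisonS]]] := comparison_exists i.
move=> [phi' [psi' [s [_ _ sE _]]]]; exists (g \o s) => x /=.
have [y /(congr1 g)] := sE x.
by rewrite gd (P0 (phi' x)) linear0 subr0 linearB => /esym/subr0_eq.
Qed.

End Comparison.
End Projective.

(** * Koszul and Tate complexes *)

Section Span.
Variable Q : comNzRingType.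
Implicit Types (s t : seq Q) (a b c : Q).

Lemma in_span0 s : in_span s 0.
Proof. by exists (fun=> 0); rewrite big1 // => i _; rewrite mul0r. Qed.

Lemma in_spanD s a b : in_span s a -> in_span s b -> in_span s (a + b).
Proof. by move=> /spanP sa /spanP sb; apply/spanP/rpredD. Qed.

Lemma in_spanM s a b : in_span s b -> in_span s (a * b).
Proof.
move=> /spanP sb; apply/spanP; rewrite -[_ * _]addr0.
exact/span_idealP/spanP/in_span0.
Qed.

Lemma in_spanN s a : in_span s a -> in_span s (- a).
Proof. by rewrite -mulN1r; apply: in_spanM. Qed.

Lemma mem_in_span s a : a \in s -> in_span s a.
Proof.
move=> sa; have i_lt : (index a s < size s)%N by rewrite index_mem.
exists (fun i => (i == Ordinal i_lt)%:R); rewrite (bigD1 (Ordinal i_lt)) //=.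
rewrite eqxx mul1r nth_index // big1 ?addr0 // => i /negPf ->.
by rewrite mul0r.
Qed.

Lemma in_span_sum s (c : 'I_(size s) -> Q) t :
  (forall i, in_span t (c i * s`_i)) -> in_span t (\sum_i c i * s`_i).
Proof.
by move=> H; apply: big_ind => //; [exact: in_span0 | exact: in_spanD].
Qed.

Lemma in_span_sub s t a : {subset s <= t} -> in_span s a -> in_span t a.
Proof.
move=> st [c ->]; apply: in_span_sum => i.
exact/in_spanM/mem_in_span/st/mem_nth.
Qed.

Lemma in_span_cons b s a :
  in_span (b :: s) a <-> exists c, in_span s (a - c * b).
Proof.
split=> [[c ->]|[c sa]].
  exists (c ord0); rewrite big_ord_recl /= addrC addKr.
  by exists (fun i => c (lift ord0 i)).
rewrite -[a](subrK (c * b)); apply: in_spanD.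
  by apply: in_span_sub sa => x; rewrite inE orbC => ->.
by apply/in_spanM/mem_in_span; rewrite mem_head.
Qed.

Lemma in_span_nil a : in_span [::] a <-> a = 0.
Proof. by split=> [[c ->]|->]; [rewrite big_ord0 | apply: in_span0]. Qed.

Lemma in_span_rev s a : in_span (rev s) a <-> in_span s a.
Proof. by split; apply: in_span_sub => x; rewrite mem_rev. Qed.

End Span.

(* Graded modules with operators [kd] and [kmu] of degree -1 and +1, which are
   in degree 0 the regular module generated by [kone]. *)
Record kcomplex (Q : comNzRingType) := KComplex {
  kmod :> nat -> lmodType Q;
  kd : forall n, {linear kmod n.+1 -> kmod n};
  kmu : forall n, {linear kmod n -> kmod n.+1};
  kone : kmod 0%N;
  keps : {linear kmod 0%N -> Q^o}
}.

Arguments kd {Q} k n.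
Arguments kmu {Q} k n.
Arguments kone {Q} k.
Arguments keps {Q} k.

Section Cone.
Variables (Q : comNzRingType) (b c : Q) (K : kcomplex Q).

(** The pair [(u, v)] stands for [u + e v] with [e] of degree 1 and [d e = b], whence the signs
    below; [c] is the coefficient of [e] in the element that [cone_mu] multiplies by. *)
Definition cone_mod (n : nat) : lmodType Q :=
  if n is m.+1 then (K m.+1 * K m)%type else K 0%N.

Definition cone_d n : {linear cone_mod n.+1 -> cone_mod n} :=
  match n with
  | 0%N => (kd K 0 \o fst) \+ (b \*: snd)
  | m.+1 => lpair ((kd K m.+1 \o fst) \+ (b \*: snd)) (\- (kd K m \o snd))
  end.

Definition cone_mu n : {linear cone_mod n -> cone_mod n.+1} :=
  match n with
  | 0%N => lpair (kmu K 0) (c \*: idfun)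
  | m.+1 => lpair (kmu K m.+1 \o fst) ((c \*: fst) \- (kmu K m \o snd))
  end.

Definition cone := KComplex cone_d cone_mu (kone K) (keps K).

End Cone.

Definition kbase (Q : comNzRingType) : kcomplex Q :=
  @KComplex Q (fun n => if n is 0%N then Q^o else 'rV[Q]_0)
    (fun n => \0) (fun n => \0) (1 : Q) idfun.

(* The Koszul complex on the first components, with the wedge product by the
   element of degree 1 whose coordinates are the second components. *)
Fixpoint kos (Q : comNzRingType) (l : seq (Q * Q)) : kcomplex Q :=
  if l is p :: l' then cone p.1 p.2 (kos l') else kbase Q.

(** * Koszul complexes: Leibniz rule, minimality, exactness *)

Section Koszul.
Variable Q : comNzRingType.
Implicit Types (l : seq (Q * Q)) (a b c : Q).

Lemma kd_kd l n x : kd (kos l) n (kd (kos l) n.+1 x) = 0.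
Proof.
elim: l n x => [|[b c] l IH] n x //=.
case: n x => [|n] [u v]; last apply: pair_ext;
  rewrite /= ?linearN /= ?IH ?oppr0 //.
  by rewrite linearD linearZ /= IH add0r subrr.
by rewrite linearD linearZ /= IH add0r subrr.
Qed.

Lemma kmu_kmu l n x : kmu (kos l) n.+1 (kmu (kos l) n x) = 0.
Proof.
elim: l n x => [|[b c] l IH] n x //=.
case: n x => [|n] x; apply: pair_ext; rewrite /= ?linearB ?linearZ /= ?IH //.
  by rewrite scalerN subrr.
by rewrite scalerN !oppr0 addr0 subrr.
Qed.

(** Writing [omega] for the degree 1 element behind [kmu], this is the scalar [d omega]. *)
Definition ktheta l : Q := \sum_(p <- l) p.2 * p.1.

Lemma kd_kmu0 l x : kd (kos l) 0 (kmu (kos l) 0 x) = ktheta l *: x.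
Proof.
rewrite /ktheta; elim: l x => [|[b c] l IH] x /=.
  by rewrite big_nil scale0r.
by rewrite big_cons IH /= scalerA -scalerDl addrC [b * c]mulrC.
Qed.

(** The Leibniz rule [d (omega x) = (d omega) x - omega (d x)]. *)
Lemma kd_kmu l n x :
  kd (kos l) n.+1 (kmu (kos l) n.+1 x) + kmu (kos l) n (kd (kos l) n x)
  = ktheta l *: x.
Proof.
elim: l n x => [|[b c] l IH] n x /=.
  by rewrite /= addr0 /ktheta big_nil scale0r.
have tE : ktheta ((b, c) :: l) = b * c + ktheta l.
  by rewrite /ktheta big_cons mulrC.
rewrite tE; case: n x => [|n] [u v]; apply: pair_ext => /=.
- rewrite (linearD (kmu (kos l) 0)) (linearZ_LR (kmu (kos l) 0)) scalerBr.
  by rewrite addrACA IH subrK addrC scalerA -scalerDl addrC.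
- rewrite (linearB (kd (kos l) 0)) (linearZ_LR (kd (kos l) 0)) kd_kmu0 opprB.
  by rewrite scalerDr addrA subrK scalerA addrC mulrC -scalerDl.
- rewrite (linearD (kmu (kos l) n.+1)) (linearZ_LR (kmu (kos l) n.+1)) scalerBr.
  by rewrite addrACA IH subrK scalerA -scalerDl addrC.
- rewrite (linearB (kd (kos l) n.+1)) (linearZ_LR (kd (kos l) n.+1)) opprB.
  rewrite (linearN (kmu (kos l) n)) opprK scalerDr -addrA addrA.
  rewrite scalerDl -IH scalerA [c * b]mulrC [LHS](AC (2*2) ((1*4)*2*3)) /=.
  by rewrite addrA subrK addrC.
Qed.

Lemma kos_projective l n : projective (kos l n).
Proof.
elim: l n => [|p l IH] [|n] /=; [exact: projective_regular | | exact: IH |].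
  by apply: projective_trivial => x; apply/rowP => -[].
exact: projective_pair.
Qed.

Lemma keps_one l : keps (kos l) (kone (kos l)) = 1.
Proof. by elim: l. Qed.

Lemma kepsK l x : (keps (kos l) x : Q) *: kone (kos l) = x.
Proof. by elim: l x => //= x; rewrite [_ *: _]mulr1. Qed.

Section Minimal.
Variable V : lmodType Q.

(** Under this condition every linear map from the Koszul complex to [V] vanishes on boundaries and
    on multiples of [omega], so that [Hom(-, V)] of the Tate complex has zero differential. *)
Definition kminimal l :=
  forall p, p \in l -> forall v : V, p.1 *: v = 0 /\ p.2 *: v = 0.

Lemma kminimal_d l n (g : {linear kos l n -> V}) x :
  kminimal l -> g (kd (kos l) n x) = 0.
Proof.
elim: l n g x => [|[b c] l IH] n g x lV /=; first by rewrite linear0.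
have lV' : kminimal l by move=> p pl; apply: lV; rewrite inE pl orbT.
have bV (v : V) : b *: v = 0 by case: (lV (b, c) (mem_head _ _) v).
case: n g x => [|n] g [u v] /=.
  by rewrite linearD linearZ /= bV addr0; apply: IH.
have -> : (kd (kos l) n.+1 u + b *: v, - kd (kos l) n v) =
    lininl _ _ (kd (kos l) n.+1 u) + b *: lininl _ _ v
    - lininr _ _ (kd (kos l) n v).
  by apply: pair_ext; rewrite /= ?scaler0 ?subr0 ?addr0 ?add0r.
have E1 : g (lininl _ _ (kd (kos l) n.+1 u)) = 0.
  exact: (IH _ (g \o lininl _ _) u lV').
have E2 : g (lininr _ _ (kd (kos l) n v)) = 0.
  exact: (IH _ (g \o lininr _ _) v lV').
by rewrite (linearB g) (linearD g) (linearZ_LR g) bV E1 E2 addr0 subr0.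
Qed.

Lemma kminimal_mu l n (g : {linear kos l n.+1 -> V}) x :
  kminimal l -> g (kmu (kos l) n x) = 0.
Proof.
elim: l n g x => [|[b c] l IH] n g x lV /=; first by rewrite linear0.
have lV' : kminimal l by move=> p pl; apply: lV; rewrite inE pl orbT.
have cV (v : V) : c *: v = 0 by case: (lV (b, c) (mem_head _ _) v).
case: n g x => [|n] g x /=.
  have -> : (kmu (kos l) 0 x, c *: x) =
      lininl _ _ (kmu (kos l) 0 x) + c *: lininr _ _ x.
    by apply: pair_ext; rewrite /= ?scaler0 ?addr0 ?add0r.
  rewrite linearD linearZ /= cV addr0.
  exact: (IH _ (g \o lininl _ _) x lV').
have -> : (kmu (kos l) n.+1 x.1, c *: x.1 - kmu (kos l) n x.2) =
    lininl _ _ (kmu (kos l) n.+1 x.1) + c *: lininr _ _ x.1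
    - lininr _ _ (kmu (kos l) n x.2).
  by apply: pair_ext; rewrite /= ?scaler0 ?subr0 ?addr0 ?add0r.
have E1 : g (lininl _ _ (kmu (kos l) n.+1 x.1)) = 0.
  exact: (IH _ (g \o lininl _ _) x.1 lV').
have E2 : g (lininr _ _ (kmu (kos l) n x.2)) = 0.
  exact: (IH _ (g \o lininr _ _) x.2 lV').
by rewrite (linearB g) (linearD g) (linearZ_LR g) cV E1 E2 addr0 subr0.
Qed.

End Minimal.

Lemma kd0_span l c :
  in_span (unzip1 l) c <-> exists x, kd (kos l) 0 x = c *: kone (kos l).
Proof.
elim: l c => [|[b e] l IH] c.
  rewrite in_span_nil; split=> [->|[x /= /esym]].
    by exists 0; rewrite scale0r linear0.
  by rewrite [_ *: _]mulr1.
rewrite in_span_cons; split=> [[a /IH [x xE]]|[[x v] xE]].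
  exists (x, a *: kone (kos l)) => /=; rewrite xE scalerA -scalerDl.
  by rewrite [b * a]mulrC subrK.
exists (keps _ v); apply/IH; exists x; rewrite scalerBl.
by move: xE => /= <-; rewrite mulrC -scalerA kepsK addrK.
Qed.

Lemma kd0_kone_span l x : in_span (unzip1 l) (keps _ (kd (kos l) 0 x)).
Proof. by apply/kd0_span; exists x; rewrite kepsK. Qed.

(** If [v = d w], then [u + b w] is a cycle of the smaller complex, hence some [d y], and [(y, - w)]
    has boundary [(u, v)]. *)
Lemma cone_cycle b e l n u v :
  (forall x, kd (kos l) n.+1 x = 0 -> exists y, kd (kos l) n.+2 y = x) ->
  (exists w, kd (kos l) n.+1 w = v) ->
  kd (kos ((b, e) :: l)) n.+1 (u, v) = 0 ->
  exists y, kd (kos ((b, e) :: l)) n.+2 y = (u, v).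
Proof.
move=> ex [w wE] /= [uE _]; have [|y yE] := ex (u + b *: w).
  by rewrite linearD linearZ /= wE.
exists (y, - w); apply: pair_ext => /=.
  by rewrite yE scalerN addrK.
by rewrite linearN opprK.
Qed.

Lemma cone_cycle0 b e l u v :
  (forall x, kd (kos l) 0 x = 0 -> exists y, kd (kos l) 1 y = x) ->
  (exists w, kd (kos l) 0 w = v) ->
  kd (kos ((b, e) :: l)) 0 (u, v) = 0 ->
  exists y, kd (kos ((b, e) :: l)) 1 y = (u, v).
Proof.
move=> ex [w wE] /= uE; have [|y yE] := ex (u + b *: w).
  by rewrite linearD linearZ /= wE.
exists (y, - w); apply: pair_ext => /=.
  by rewrite yE scalerN addrK.
by rewrite linearN opprK.
Qed.

(** The head of the list is the outermost cone, so [l] runs through [s] backwards and the induction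
    removes the last element of [s]. *)
Lemma koszul_exact (s : seq Q) l n x :
  regular_sequence s -> unzip1 l = rev s ->
  kd (kos l) n x = 0 -> exists y, kd (kos l) n.+1 y = x.
Proof.
case=> _; elim/last_ind: s l n x => [|s b IH] [|[b' e] l] n x //=.
- by move=> _ _ _; exists 0; apply/rowP => -[].
- by rewrite rev_rcons.
rewrite rev_rcons => reg [-> lE]; move=> xE.
have {}IH m y : kd (kos l) m y = 0 -> exists z, kd (kos l) m.+1 z = y.
  apply: (IH l) => // i a i_lt.
  have := reg i a; rewrite size_rcons nth_rcons i_lt -cats1.
  by rewrite takel_cat ?(ltnW i_lt) //; apply; apply: ltnW.
case: n x xE => [|n] [u v] xE; last first.
  apply: (@cone_cycle b e l n u v) (xE); first by move=> ?; apply: IH.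
  by apply: IH; move/(congr1 snd): (xE) => /= /eqP; rewrite oppr_eq0 => /eqP.
apply: (@cone_cycle0 b e l u v) (xE); first by move=> ?; apply: IH.
suff /kd0_span [w wE] : in_span (unzip1 l) (keps _ v).
  by exists w; rewrite wE kepsK.
(* For a cycle [(u, v)] of degree 1, [b v = - d u] lies in the ideal of the preceding elements; by
   regularity so does [v], which makes it a boundary. *)
have := reg (size s) (keps _ v).
rewrite size_rcons nth_rcons ltnn eqxx -cats1 take_size_cat // lE.
rewrite in_span_rev; apply=> //; rewrite -(in_span_rev s) -lE.
have -> : b * keps _ v = keps (kos l) (b *: v) by rewrite linearZ.
move: xE => /= /eqP; rewrite addrC addr_eq0 => /eqP ->.
by rewrite linearN; apply/in_spanN/kd0_kone_span.
Qed.

End Koszul.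

(** * The Tate resolution of [Q/(J, Y)] *)

Section Tate.
Variables (Q : comNzRingType) (X Y : Q) (l : seq (Q * Q)).
Local Notation K := (kos l).
Local Notation L := (kos ((Y, X) :: l)).
Local Notation J := (in_span (unzip1 l)).
Hypothesis theta0 : ktheta ((Y, X) :: l) = 0.
Hypothesis K_exact : forall n x, kd K n x = 0 -> exists y, kd K n.+1 y = x.
Hypothesis annY : forall c, J (Y * c) -> exists u, J (c - X * u).
Hypothesis annX : forall c, J (X * c) -> exists u, J (c - Y * u).

Lemma L_exact n x : kd L n.+1 x = 0 -> exists y, kd L n.+2 y = x.
Proof.
case: x => u v xE; apply: (@cone_cycle Q Y X l n u v) (xE).
  by move=> x; apply: K_exact.
apply: K_exact.
by move/(congr1 snd): xE => /= /eqP; rewrite oppr_eq0 => /eqP.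
Qed.

(** Together with [L_boundary0]: [H_1(L)] is free of rank one over [H_0(L)] on the class of
    [kmu L 0 (kone L)], the class to be killed by the divided power variable. *)
Lemma L_cycle1 x : kd L 0 x = 0 ->
  exists c y, x = c *: kmu L 0 (kone L) + kd L 1 y.
Proof.
case: x => u v xE; have /annY [t tJ] : J (Y * keps K v).
  have -> : Y * keps K v = keps K (Y *: v) by rewrite linearZ.
  move: (xE) => /= /eqP; rewrite addrC addr_eq0 => /eqP ->.
  by rewrite linearN; apply/in_spanN/kd0_kone_span.
(* The second component of [c] is [X], so that of [x'] is [v - t X], which lies in [J] and is
   therefore a boundary of [K]. *)
pose c := kmu L 0 (kone L); pose x' := ((u, v) : L 1%N) - t *: c.
have [|||y yE] := @cone_cycle0 Q Y X l x'.1 x'.2.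
- by move=> z; apply: K_exact.
- move/kd0_span: tJ => [w wE]; exists w; rewrite wE scalerBl kepsK /= scalerA.
  by rewrite mulrC.
- rewrite -surjective_pairing linearB linearZ_LR xE [kd _ _ c]kd_kmu0 theta0.
  by rewrite scale0r scaler0 subr0.
by exists t, y; rewrite yE -surjective_pairing addrC subrK.
Qed.

(** The second component of the given boundary is [X v], and it lies in [J]; so [annX] puts [v] in
    [J + (Y)]. *)
Lemma L_boundary0 v : (exists y, kd L 1 y = kmu L 0 v) ->
  exists w, kd L 0 w = v.
Proof.
case=> -[p q] /(congr1 snd) /= qE; have /annX [u uJ] : J (X * keps K v).
  have -> : X * keps K v = keps K (X *: v) by rewrite linearZ.
  by rewrite -qE linearN; apply/in_spanN/kd0_kone_span.
suff /kd0_span [w wE] : in_span (unzip1 ((Y, X) :: l)) (keps K v).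
  by exists w; apply: etrans wE (kepsK _).
by apply/in_span_cons; exists u; rewrite mulrC.
Qed.

(* The n-th term is the sum of the [L n.-2i u^(i)], where [u] is a divided
   power variable of degree 2 whose boundary is the cycle [kmu L 0 (kone L)]. *)
Fixpoint tate n : lmodType Q :=
  match n with
  | 0%N => L 0%N
  | 1%N => L 1%N
  | (m.+1 as m').+1 => (L m'.+1 * tate m)%type
  end.

Definition tproj n : {linear tate n -> L n} :=
  match n with
  | 0%N | 1%N => idfun
  | m.+2 => fst
  end.

(** The rule is [d (u^(i) t) = u^(i-1) omega t + u^(i) (d t)]. Only the leading component of [t]
    lands in the top summand, whence [tproj]; the recursive call supplies the other terms. *)
Fixpoint tate_d n : {linear tate n.+1 -> tate n} :=
  match n with
  | 0%N => kd L 0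
  | 1%N => (kd L 1 \o fst) \+ (kmu L 0 \o snd)
  | m.+2 => lpair ((kd L m.+2 \o fst) \+ (kmu L m.+1 \o tproj m.+1 \o snd))
              (tate_d m \o snd)
  end.

Lemma kmu_tproj n t :
  kmu L n (tproj n (tate_d n t)) = kmu L n (kd L n (tproj n.+1 t)).
Proof.
case: n t => [|[|n]] t //; first last.
  have -> : tproj n.+2 (tate_d n.+2 t) =
    kd L n.+2 (tproj n.+3 t) + kmu L n.+1 (tproj n.+1 t.2) by [].
  by rewrite linearD kmu_kmu addr0.
have -> : tproj 1 (tate_d 1 t) = kd L 1 (tproj 2 t) + kmu L 0 t.2 by [].
by rewrite linearD kmu_kmu addr0.
Qed.

Lemma kdmu n x : kd L n.+1 (kmu L n.+1 x) = - kmu L n (kd L n x).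
Proof. by apply/eqP; rewrite -addr_eq0 kd_kmu theta0 scale0r. Qed.

(** Since [tate] recurses two degrees down, the induction carries two consecutive degrees. Its base
    rests on [L_cycle1] and [L_boundary0]. *)
Lemma tate_exactP n t : tate_d n t = 0 -> exists s, tate_d n.+1 s = t.
Proof.
suff [] : (forall t, tate_d n t = 0 -> exists s, tate_d n.+1 s = t) /\
  (forall t, tate_d n.+1 t = 0 -> exists s, tate_d n.+2 s = t).
  by move=> + _; apply.
(* If [t' = d s'], then [a - omega s'], taken with the leading component of [s'], is a cycle of [L]
   of degree at least 2, hence a boundary [d b]; the preimage is [(b, s')]. *)
have lift m (a : L m.+2) (t' : tate m) :
    kd L m.+1 a + kmu L m (tproj m t') = 0 ->
    (exists s', tate_d m s' = t') ->
    exists s, tate_d m.+2 s = (a, t').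
  move=> aE [s' s'E].
  have [|b bE] := @L_exact m (a - kmu L m.+1 (tproj m.+1 s')).
    by rewrite linearB kdmu opprK -kmu_tproj s'E.
  exists (b, s'); apply: pair_ext; rewrite //=.
  by have /= -> := bE; rewrite subrK.
elim: n {t} => [|n [IH0 IH1]].
  split=> [t /L_cycle1 [c [y ->]]|[a t'] tE].
    by exists (y, c *: kone L); rewrite -(linearZ_LR (kmu L 0)) addrC.
  apply: lift; first exact: tE.
  apply: L_boundary0; exists (- a); rewrite linearN.
  by apply/eqP; rewrite eqr_oppLR -addr_eq0; apply/eqP; exact: tE.
split=> // -[a t'] tE; apply: lift; first exact: (congr1 fst tE).
by apply: IH0; exact: (congr1 snd tE).
Qed.

Lemma tate_d2 n t : tate_d n (tate_d n.+1 t) = 0.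
Proof.
have pairE m (s : tate m.+3) :
    kd L m.+2 s.1 + kmu L m.+1 (tproj m.+1 s.2) = (tate_d m.+2 s).1 by [].
suff [] : (forall t, tate_d n (tate_d n.+1 t) = 0) /\
  (forall t, tate_d n.+1 (tate_d n.+2 t) = 0).
  by move=> + _; apply.
have top m (s : tate m.+3) :
    kd L m.+1 (tate_d m.+2 s).1 + kmu L m (tproj m (tate_d m s.2)) = 0.
  have -> : (tate_d m.+2 s).1 = kd L m.+2 s.1 + kmu L m.+1 (tproj m.+1 s.2).
    by [].
  by rewrite linearD kd_kd add0r kdmu kmu_tproj addNr.
elim: n {t} => [|n [IH0 IH1]].
  split=> [t|]; last exact: (top 0%N).
  have -> : tate_d 1 t = kd L 1 t.1 + kmu L 0 t.2 by [].
  by rewrite (linearD (kd L 0)) kd_kd kd_kmu0 theta0 scale0r addr0.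
split=> // t; apply: pair_ext; first exact: (top n.+1).
exact: (IH0 t.2).
Qed.

Lemma tate_exact n : exact_at (tate_d n.+1) (tate_d n).
Proof.
by move=> t; split=> [/tate_exactP|[s <-]] //; apply: tate_d2.
Qed.

Lemma tate_projective n : projective (tate n).
Proof.
suff [] : projective (tate n) /\ projective (tate n.+1) by [].
elim: n => [|n [IH0 IH1]]; first by split; apply: kos_projective.
by split=> //; apply: projective_pair; first exact: kos_projective.
Qed.

Section TateMinimal.
Variable V : lmodType Q.
Hypothesis V_min : kminimal V ((Y, X) :: l).

Lemma tate_minimal n (g : {linear tate n -> V}) t : g (tate_d n t) = 0.
Proof.
suff [] : (forall (g : {linear tate n -> V}) t, g (tate_d n t) = 0) /\
  (forall (g : {linear tate n.+1 -> V}) t, g (tate_d n.+1 t) = 0).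
  by move=> + _; apply.
elim: n {g t} => [|n [IH0 IH1]].
  split=> [g t|g t]; first exact: kminimal_d.
  have -> : tate_d 1 t = kd L 1 t.1 + kmu L 0 t.2 by [].
  by rewrite (linearD g) kminimal_d // kminimal_mu // addr0.
split=> // g t.
have -> : tate_d n.+2 t = lininl _ _ (kd L n.+2 t.1) +
    lininl _ _ (kmu L n.+1 (tproj n.+1 t.2)) + lininr _ _ (tate_d n t.2).
  by apply: pair_ext; rewrite /= ?addr0 ?add0r.
rewrite !(linearD g).
have E1 := @kminimal_d _ V _ _ (g \o lininl _ _) t.1 V_min.
have E2 := @kminimal_mu _ V _ _ (g \o lininl _ _) (tproj n.+1 t.2) V_min.
have E3 := IH0 (g \o lininr _ _) t.2.
by move: E1 E2 E3 => /= -> -> ->; rewrite !addr0.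
Qed.

(** The map reads off the coefficient of [u^(i)], an element of [L 0 = Q], and multiplies [v] by
    it. *)
Lemma tate_functional i (v : V) : v != 0 ->
  exists (g : {linear tate i.*2 -> V}) t, g t != 0.
Proof.
move=> v0; elim: i => [|i [g [t gt0]]].
  exists (act v \o keps K), (kone K); rewrite /= keps_one scale1r.
  exact: v0.
by exists (g \o snd), (0, t).
Qed.

End TateMinimal.
End Tate.

(** The hypotheses identify [M] with [Q/(s, Y)] and make its Tate resolution minimal with respect to
    [V]. Hence all cochains are cocycles and all coboundaries vanish, so [Ext^(2i)(M, V)] is nonzero
    for every [i]. *)
Theorem infinite_projective_dimension (Q : comNzRingType) (M V : lmodType Q)
    (m0 : M) (v : V) (s : seq Q) (a : 'I_(size s) -> Q) (X Y : Q) :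
  regular_sequence s ->
  X * Y = \sum_i a i * s`_i ->
  (forall c, in_span s (Y * c) -> exists u, in_span s (c - X * u)) ->
  (forall c, in_span s (X * c) -> exists u, in_span s (c - Y * u)) ->
  (forall m : M, exists c, m = c *: m0) ->
  (forall c, c *: m0 = 0 <-> exists u, in_span s (c - Y * u)) ->
  v != 0 ->
  (forall w : V, [/\ X *: w = 0, Y *: w = 0, forall b, b \in s -> b *: w = 0
    & forall i, a i *: w = 0]) ->
  ~ finite_projective_dimension M.
Proof.
move=> reg XY annY annX gen ker v0 V0 [n [P [dP [augP]]]].
case=> P_proj P0 augP_surj exP0 exP.
(* The sign makes [ktheta ((Y, X) :: l)] equal to [X Y - sum a_i s_i = 0]; the reversal is the one
   of [koszul_exact]. *)
pose l := rev [seq (s`_i, - a i) | i : 'I_(size s)].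
have l1 : unzip1 l = rev s.
  rewrite /unzip1 map_rev -map_comp /=; congr rev.
  by rewrite -[RHS](mkseq_nth 0) /mkseq -val_enum_ord -map_comp.
have JE c : in_span (unzip1 l) c <-> in_span s c by rewrite l1 in_span_rev.
have theta0 : ktheta ((Y, X) :: l) = 0.
  rewrite /ktheta big_cons /= /l (perm_big _ (permEl (perm_rev _))) big_map.
  rewrite big_enum /= XY -big_split big1 // => i _ /=.
  by rewrite mulNr subrr.
have K_exact k x : kd (kos l) k x = 0 -> exists y, kd (kos l) k.+1 y = x.
  exact: koszul_exact reg l1.
have annY' c : in_span (unzip1 l) (Y * c) ->
    exists u, in_span (unzip1 l) (c - X * u).
  by move/JE/annY => [u uJ]; exists u; apply/JE.
have annX' c : in_span (unzip1 l) (X * c) ->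
    exists u, in_span (unzip1 l) (c - Y * u).
  by move/JE/annX => [u uJ]; exists u; apply/JE.
have V_min : kminimal V ((Y, X) :: l).
  move=> p pl w; have [Xw Yw sw aw] := V0 w.
  move: pl; rewrite inE => /orP [/eqP -> //|].
  rewrite mem_rev => /imageP [i _ ->] /=.
  by rewrite sw ?mem_nth // scaleNr aw oppr0.
pose augT : {linear tate X Y l 0 -> M} := act m0 \o keps (kos l).
have augT_surj : surjective augT.
  move=> m; have [c ->] := gen m; exists (c *: kone (kos l)).
  by rewrite /augT /= linearZ /= keps_one [_ *: 1]mulr1.
have exT0 : exact_at (tate_d X Y l 0) augT.
  move=> t; rewrite /augT /= ker; split=> [[u /JE uJ]|[t' <-]].
    have /kd0_span [w wE] : in_span (unzip1 ((Y, X) :: l)) (keps (kos l) t).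
      by apply/in_span_cons; exists u; rewrite mulrC.
    by exists w; apply: etrans wE (kepsK _).
  have /in_span_cons [u uJ] := @kd0_kone_span Q ((Y, X) :: l) t'.
  by exists u; apply/JE; rewrite mulrC.
(* The degree [2(n+1)] exceeds [n], so the finite resolution is zero there. *)
have [g [t]] := @tate_functional Q X Y l V n.+1 v v0.
have [|x|h ->] := cocycle_coboundary P_proj (@tate_projective Q X Y l) augP_surj
  augT_surj exP0 exT0 exP (tate_exact theta0 K_exact annY' annX') (g := g).
- move=> x; apply: P0; change (n < n.*2.+2)%N.
  by rewrite ltnS -addnn leqW // leq_addr.
- exact: tate_minimal.
by rewrite tate_minimal // eqxx.
Qed.

(** * The ring R *)

(** This is the multiplication table of R on its basis, in any ring satisfying the relations; it
    makes [of_coord] multiplicative. *)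
Lemma normal_form_mul (A : comNzRingType) (w x y z : A)
    (a0 aw ax ay az ap aq ar b0 bw bx b_y bz bp bq br : A) :
  w * w = 0 -> w * x = y * y -> w * y = x * z -> w * z = 0 ->
  x * x = - (y * z) -> x * y = 0 -> z * z = 0 ->
  a0 * b0 + (a0 * bw + aw * b0) * w + (a0 * bx + ax * b0) * x
  + (a0 * b_y + ay * b0) * y
  + (a0 * bz + az * b0) * z
  + (a0 * bp + ap * b0 + aw * bx + ax * bw + ay * b_y) * (w * x)
  + (a0 * bq + aq * b0 + aw * b_y + ay * bw + ax * bz + az * bx) * (w * y)
  + (a0 * br + ar * b0 + ax * bx - ay * bz - az * b_y) * (x * x)
  = (a0 + aw * w + ax * x + ay * y + az * z + ap * (w * x) + aq * (w * y)
     + ar * (x * x))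
    * (b0 + bw * w + bx * x + b_y * y + bz * z + bp * (w * x) + bq * (w * y)
       + br * (x * x)).
Proof.
move=> ww wx wy wz xx xy zz.
have wwx : w * (w * x) = 0 by rewrite mulrA ww mul0r.
have wwy : w * (w * y) = 0 by rewrite mulrA ww mul0r.
have wxx : w * (x * x) = 0 by rewrite mulrA wx -mulrA [y * x]mulrC xy mulr0.
have xwx : x * (w * x) = 0 by rewrite mulrCA.
have xwy : x * (w * y) = 0 by rewrite mulrCA xy mulr0.
have xxx : x * (x * x) = 0 by rewrite xx mulrN mulrA xy mul0r oppr0.
have ywx : y * (w * x) = 0 by rewrite mulrCA [y * x]mulrC xy mulr0.
have ywy : y * (w * y) = 0 by rewrite wy mulrA [y * x]mulrC xy mul0r.
have yxx : y * (x * x) = 0 by rewrite mulrA [y * x]mulrC xy mul0r.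
have zwx : z * (w * x) = 0 by rewrite mulrA [z * w]mulrC wz mul0r.
have zwy : z * (w * y) = 0 by rewrite mulrA [z * w]mulrC wz mul0r.
have zxx : z * (x * x) = 0 by rewrite xx mulrN mulrCA zz mulr0 oppr0.
have xz_wy : x * z - w * y = 0 by rewrite wy subrr.
have yy_wx : y * y - w * x = 0 by rewrite wx subrr.
have yz_xx : y * z + x * x = 0 by rewrite xx subrr.
(* The added terms are multiples of the relations and of monomials of degree 3 and 4, all zero in
   [A]; with them the claim is a polynomial identity. *)
transitivity (a0 * b0 + (a0 * bw + aw * b0) * w + (a0 * bx + ax * b0) * x
  + (a0 * b_y + ay * b0) * y
  + (a0 * bz + az * b0) * z
  + (a0 * bp + ap * b0 + aw * bx + ax * bw + ay * b_y) * (w * x)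
  + (a0 * bq + aq * b0 + aw * b_y + ay * bw + ax * bz + az * bx) * (w * y)
  + (a0 * br + ar * b0 + ax * bx - ay * bz - az * b_y) * (x * x)
  + ((aw * bw) * (w * w)
     + (aw * bz + az * bw) * (w * z)
     + (ax * b_y + ay * bx) * (x * y)
     + (ax * bz + az * bx) * (x * z - w * y)
     + (ay * b_y) * (y * y - w * x)
     + (ay * bz + az * b_y) * (y * z + x * x)
     + (az * bz) * (z * z)
     + (aw * bp + ap * bw) * (w * (w * x))
     + (aw * bq + aq * bw) * (w * (w * y))
     + (aw * br + ar * bw) * (w * (x * x))
     + (ax * bp + ap * bx) * (x * (w * x))
     + (ax * bq + aq * bx) * (x * (w * y))
     + (ax * br + ar * bx) * (x * (x * x))
     + (ay * bp + ap * b_y) * (y * (w * x))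
     + (ay * bq + aq * b_y) * (y * (w * y))
     + (ay * br + ar * b_y) * (y * (x * x))
     + (az * bp + ap * bz) * (z * (w * x))
     + (az * bq + aq * bz) * (z * (w * y))
     + (az * br + ar * bz) * (z * (x * x))
     + (ap * bp) * (w * (x * (w * x)))
     + (ap * bq) * (w * (y * (w * x)))
     + (ap * br) * (x * (x * (w * x)))
     + (aq * bp) * (w * (x * (w * y)))
     + (aq * bq) * (w * (y * (w * y)))
     + (aq * br) * (x * (x * (w * y)))
     + (ar * bp) * (w * (x * (x * x)))
     + (ar * bq) * (w * (y * (x * x)))
     + (ar * br) * (x * (x * (x * x))))).
  rewrite xz_wy yy_wx yz_xx ww wz xy zz !(wwx, wwy, wxx, xwx, xwy, xxx).
  by rewrite !(ywx, ywy, yxx, zwx, zwy, zxx) !mulr0 !addr0.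
ring.
Qed.

(* Coordinates on the basis 1, w, x, y, z, wx = y^2, wy = xz, x^2 = -yz. *)
Record alg8 (k : fieldType) := Alg8 {
  c1 : k; cw : k; cx : k; cy : k; cz : k; cwx : k; cwy : k; cxx : k }.
HB.instance Definition _ k := gen_eqMixin (alg8 k).
HB.instance Definition _ k := gen_choiceMixin (alg8 k).

Section Alg8.
Variable k : fieldType.
Implicit Types a b c : alg8 k.

Lemma alg8_eq (a0 aw ax ay az a5 a6 a7 b0 bw bx b_y bz b5 b6 b7 : k) :
  a0 = b0 -> aw = bw -> ax = bx -> ay = b_y -> az = bz -> a5 = b5 -> a6 = b6 ->
  a7 = b7 -> Alg8 a0 aw ax ay az a5 a6 a7 = Alg8 b0 bw bx b_y bz b5 b6 b7.
Proof. by do 8!move=> ->. Qed.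

Lemma alg8P a b :
  c1 a = c1 b -> cw a = cw b -> cx a = cx b -> cy a = cy b -> cz a = cz b ->
  cwx a = cwx b -> cwy a = cwy b -> cxx a = cxx b -> a = b.
Proof. by case: a b => [????????] [????????] /=; apply: alg8_eq. Qed.

Definition alg8_zero : alg8 k := Alg8 0 0 0 0 0 0 0 0.
Definition alg8_one : alg8 k := Alg8 1 0 0 0 0 0 0 0.
Definition alg8_opp a : alg8 k :=
  Alg8 (- c1 a) (- cw a) (- cx a) (- cy a) (- cz a) (- cwx a) (- cwy a)
    (- cxx a).
Definition alg8_add a b : alg8 k :=
  Alg8 (c1 a + c1 b) (cw a + cw b) (cx a + cx b) (cy a + cy b) (cz a + cz b)
    (cwx a + cwx b) (cwy a + cwy b) (cxx a + cxx b).
Definition alg8_mul a b : alg8 k :=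
  Alg8 (c1 a * c1 b) (c1 a * cw b + cw a * c1 b) (c1 a * cx b + cx a * c1 b)
    (c1 a * cy b + cy a * c1 b) (c1 a * cz b + cz a * c1 b)
    (c1 a * cwx b + cwx a * c1 b + cw a * cx b + cx a * cw b + cy a * cy b)
    (c1 a * cwy b + cwy a * c1 b + cw a * cy b + cy a * cw b
     + cx a * cz b + cz a * cx b)
    (c1 a * cxx b + cxx a * c1 b + cx a * cx b - cy a * cz b - cz a * cy b).

Fact alg8_addA : associative alg8_add.
Proof.
by move=> [????????] [????????] [????????]; apply: alg8_eq => /=; ring.
Qed.
Fact alg8_addC : commutative alg8_add.
Proof.
by move=> [????????] [????????]; apply: alg8_eq => /=; ring.
Qed.
Fact alg8_add0 : left_id alg8_zero alg8_add.
Proof.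
by move=> [????????]; apply: alg8_eq => /=; ring.
Qed.
Fact alg8_addN : left_inverse alg8_zero alg8_opp alg8_add.
Proof.
by move=> [????????]; apply: alg8_eq => /=; ring.
Qed.
HB.instance Definition _ := GRing.isZmodule.Build (alg8 k)
  alg8_addA alg8_addC alg8_add0 alg8_addN.

Fact alg8_mulA : associative alg8_mul.
Proof.
by move=> [????????] [????????] [????????]; apply: alg8_eq => /=; ring.
Qed.
Fact alg8_mulC : commutative alg8_mul.
Proof.
by move=> [????????] [????????]; apply: alg8_eq => /=; ring.
Qed.
Fact alg8_mul1 : left_id alg8_one alg8_mul.
Proof.
by move=> [????????]; apply: alg8_eq => /=; ring.
Qed.
Fact alg8_mulD : left_distributive alg8_mul alg8_add.
Proof.
by move=> [????????] [????????] [????????]; apply: alg8_eq => /=; ring.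
Qed.
Fact alg8_1_neq0 : alg8_one != 0.
Proof. by apply/eqP => -[] /eqP; rewrite oner_eq0. Qed.
HB.instance Definition _ := GRing.Zmodule_isComNzRing.Build (alg8 k)
  alg8_mulA alg8_mulC alg8_mul1 alg8_mulD alg8_1_neq0.

Definition alg8C (c : k) : alg8 k := Alg8 c 0 0 0 0 0 0 0.
Fact alg8C_zmod : zmod_morphism alg8C.
Proof. by move=> a b; apply: alg8_eq => /=; ring. Qed.
HB.instance Definition _ := GRing.isZmodMorphism.Build k (alg8 k) alg8C
  alg8C_zmod.
Fact alg8C_monoid : monoid_morphism alg8C.
Proof. by split=> [|a b] //; apply: alg8_eq => /=; ring. Qed.
HB.instance Definition _ := GRing.isMonoidMorphism.Build k (alg8 k) alg8C
  alg8C_monoid.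

Definition alg8X (i : 'I_4) : alg8 k :=
  nth (0 : alg8 k) [:: Alg8 0 1 0 0 0 0 0 0; Alg8 0 0 1 0 0 0 0 0;
            Alg8 0 0 0 1 0 0 0 0; Alg8 0 0 0 0 1 0 0 0] i.

Definition alg8_eval : {rmorphism {mpoly k[4]} -> alg8 k} := mmap alg8C alg8X.

Lemma alg8_evalX (i : nat) :
  (i < 4)%N -> alg8_eval 'X_(inord i) = alg8X (inord i).
Proof. by move=> i4; rewrite /alg8_eval /= mmapX mmap1U. Qed.

Lemma alg8_eval_relation p : p \in @relation_ideal k -> alg8_eval p = 0.
Proof.
case/spanP=> c ->; rewrite raddf_sum /= big1 // => i _; rewrite rmorphM.
suff -> : alg8_eval (@relations k)`_i = 0 by rewrite mulr0.
case: i => -[|[|[|[|[|[|[|i]]]]]]] //= _;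
  rewrite !(rmorphB, rmorphD, rmorphM, rmorphXn) !alg8_evalX ?expr2 //;
  rewrite /alg8X !inordK //.
all: by apply: alg8P => /=; ring.
Qed.

Local Notation R := (exampleR k).
Definition toR : {rmorphism {mpoly k[4]} -> R} := \pi_R.

Lemma toR_eq p q : (toR p == toR q) = (p - q \in @relation_ideal k).
Proof. by rewrite Quotient.idealrBE. Qed.

(** As [alg8_eval] kills the relations, the choice of representative is immaterial. With its inverse
    [of_coord], this identifies R with [alg8 k]. *)
Definition coord (r : R) : alg8 k := alg8_eval (repr r).

Lemma coord_toR p : coord (toR p) = alg8_eval p.
Proof.
apply/subr0_eq; rewrite -rmorphB; apply: alg8_eval_relation.
by rewrite -toR_eq /toR /= reprK.
Qed.

Lemma toR_surj r : exists p, r = toR p.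
Proof. by exists (repr r); rewrite /toR /= reprK. Qed.

Fact coord_zmod : zmod_morphism coord.
Proof.
move=> r s; have [p ->] := toR_surj r; have [q ->] := toR_surj s.
by rewrite -rmorphB !coord_toR rmorphB.
Qed.
HB.instance Definition _ := GRing.isZmodMorphism.Build R (alg8 k) coord
  coord_zmod.
Fact coord_monoid : monoid_morphism coord.
Proof.
split=> [|r s]; first by rewrite -(rmorph1 toR) coord_toR rmorph1.
have [p ->] := toR_surj r; have [q ->] := toR_surj s.
by rewrite -rmorphM !coord_toR rmorphM.
Qed.
HB.instance Definition _ := GRing.isMonoidMorphism.Build R (alg8 k) coord
  coord_monoid.

Definition rX (i : nat) : R := toR 'X_(inord i).
Definition rC (c : k) : R := toR c%:MP.

Lemma toR_relation p : p \in @relations k -> toR p = 0.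
Proof.
move=> p_rel; apply/eqP; rewrite -(rmorph0 toR) toR_eq subr0.
exact/spanP/mem_in_span.
Qed.

Definition of_coord (a : alg8 k) : R :=
  rC (c1 a) + rC (cw a) * rX 0 + rC (cx a) * rX 1 + rC (cy a) * rX 2
  + rC (cz a) * rX 3 + rC (cwx a) * (rX 0 * rX 1) + rC (cwy a) * (rX 0 * rX 2)
  + rC (cxx a) * (rX 1 * rX 1).

Lemma rCD : {morph rC : a b / a + b}.
Proof. by move=> a b; rewrite /rC !rmorphD. Qed.
Lemma rCM : {morph rC : a b / a * b}.
Proof. by move=> a b; rewrite /rC !rmorphM. Qed.
Lemma rCN : {morph rC : a / - a}.
Proof. by move=> a; rewrite /rC !rmorphN. Qed.
Lemma rC0 : rC 0 = 0. Proof. by rewrite /rC !rmorph0. Qed.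
Lemma rC1 : rC 1 = 1. Proof. by rewrite /rC !rmorph1. Qed.

Lemma exampleR_relations :
  [/\ rX 0 * rX 0 = 0, rX 0 * rX 1 = rX 2 * rX 2, rX 0 * rX 2 = rX 1 * rX 3
    & [/\ rX 0 * rX 3 = 0, rX 1 * rX 1 = - (rX 2 * rX 3), rX 1 * rX 2 = 0
    & rX 3 * rX 3 = 0]].
Proof.
have rel i : (i < 7)%N -> toR (@relations k)`_i = 0.
  by move=> i7; apply/toR_relation/mem_nth.
have := (rel 0%N isT, rel 1%N isT, rel 2%N isT, rel 3%N isT, rel 4%N isT,
  rel 5%N isT, rel 6%N isT).
rewrite /relations /= !expr2 !(rmorphB, rmorphD, rmorphM) -!/(rX _).
case; case; case; case; case; case=> -> /subr0_eq -> /subr0_eq -> -> /eqP.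
by rewrite addr_eq0 => /eqP -> -> ->.
Qed.

Lemma of_coordM a b : of_coord (a * b) = of_coord a * of_coord b.
Proof.
rewrite /of_coord /= !(rCD, rCN, rCM).
have [ww wx wy [wz xx xy zz]] := exampleR_relations.
exact: normal_form_mul.
Qed.

Lemma of_coordD : {morph of_coord : a b / a + b}.
Proof.
by move=> a b; rewrite /of_coord /= !rCD; ring.
Qed.

Lemma of_coordC (c : k) : of_coord (alg8C c) = rC c.
Proof. by rewrite /of_coord /= !rC0; ring. Qed.

(** Both sides are additive and multiplicative and agree on constants and variables. Hence the eight
    basis monomials span R. *)
Lemma of_coord_eval p : of_coord (alg8_eval p) = toR p.
Proof.
elim/mpolyind: p => [|c m p _ _ IH].
  by rewrite !rmorph0 -rC0 -of_coordC.
rewrite !rmorphD of_coordD IH; congr (_ + _).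
rewrite -mul_mpolyC !rmorphM of_coordM; congr (_ * _).
  by rewrite /alg8_eval /= mmapC of_coordC.
rewrite mpolyXE_id !rmorph_prod /=.
have oc1 : of_coord 1 = 1 by rewrite -rC1 -of_coordC.
rewrite (big_morph of_coord of_coordM oc1); apply: eq_bigr => i _.
rewrite !rmorphXn /=.
have -> : of_coord (alg8_eval 'X_i ^+ m i) = of_coord (alg8_eval 'X_i) ^+ m i.
  by elim: (m i) => [|n IHn]; rewrite ?expr0 ?exprS ?of_coordM ?IHn.
congr (_ ^+ _); rewrite -(inord_val i) alg8_evalX // /alg8X inordK // /of_coord.
by case: i => -[|[|[|[|i]]]] i4 //=; rewrite !rC0 !rC1; ring.
Qed.

Lemma coordK : cancel coord of_coord.
Proof.
by move=> r; have [p ->] := toR_surj r; rewrite coord_toR of_coord_eval.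
Qed.
End Alg8.

(** * R is a noetherian local ring; annihilators of x and y *)

Section LocalExample.
Variable k : fieldType.
Local Notation R := (exampleR k).

Lemma coord_inj : injective (@coord k).
Proof. exact: can_inj (@coordK k). Qed.

Lemma coord_rX i : (i < 4)%N -> coord (rX k i) = alg8X k (inord i).
Proof. by move=> i4; rewrite coord_toR alg8_evalX. Qed.

Lemma coord_rC c : coord (rC c) = alg8C c :> alg8 k.
Proof. by rewrite coord_toR /alg8_eval /= mmapC. Qed.

Lemma coordD : {morph @coord k : r s / r + s}. Proof. exact: rmorphD. Qed.
Lemma coordB : {morph @coord k : r s / r - s}. Proof. exact: rmorphB. Qed.
Lemma coordM : {morph @coord k : r s / r * s}. Proof. exact: rmorphM. Qed.
Lemma coord0 : @coord k 0 = 0. Proof. exact: rmorph0. Qed.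
Lemma coord1 : @coord k 1 = 1. Proof. exact: rmorph1. Qed.

(** This is the linear independence of the eight monomials. *)
Lemma of_coordK : cancel (@of_coord k) (@coord k).
Proof.
move=> a; rewrite /of_coord !(coordD, coordM) !coord_rX // !coord_rC.
rewrite /alg8X !inordK //=; apply: alg8P => /=; ring.
Qed.

Definition rmax : {pred R} := fun r => c1 (coord r) == 0.

Fact rmax_closed : idealr_closed rmax.
Proof.
split; rewrite ?unfold_in /rmax ?coord0 ?coord1 ?eqxx ?oner_eq0 //.
move=> a x y; rewrite !unfold_in /rmax coordD coordM.
move: (coord a) (coord x) (coord y) => {}a {}x {}y /eqP xm /eqP ym /=.
by rewrite xm ym mulr0 addr0 eqxx.
Qed.
HB.instance Definition _ := isIdealr.Build R rmax rmax_closed.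

Lemma alg8_cube_eq0 (n : alg8 k) : c1 n = 0 -> n * n * n = 0.
Proof. by move=> n0; apply: alg8P; rewrite /= !n0; ring. Qed.

(** If [c] is the constant coordinate, [n = 1 - r/c] satisfies [n^3 = 0], and [1 + n + n^2] inverts
    [r/c]. *)
Lemma rmax_unit r : r \notin rmax -> exists s, s * r = 1.
Proof.
rewrite unfold_in /rmax => r0; pose d := (c1 (coord r))^-1.
pose n := 1 - alg8C d * coord r; have n3 : n * n * n = 0.
  by apply: alg8_cube_eq0; rewrite /= mulVf ?subrr.
exists (of_coord ((1 + n + n * n) * alg8C d)); apply: coord_inj.
rewrite coordM of_coordK coord1 -mulrA.
have -> : alg8C d * coord r = 1 - n by rewrite /n opprB addrC subrK.
have -> : (1 + n + n * n) * (1 - n) = 1 - n * n * n by ring.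
by rewrite n3 subr0.
Qed.

Lemma proper_sub_rmax (J : idealr R) : {subset J <= rmax}.
Proof.
move=> r rJ; apply: contraT => /rmax_unit [s sr1].
by have := idealMr s rJ; rewrite sr1 idealr1.
Qed.

Lemma rmax_maximal : maximal_ideal (rmax : idealr R).
Proof. by move=> J _; apply: proper_sub_rmax. Qed.

Lemma span_sub_ideal (I : idealr R) (s : seq R) a :
  {subset s <= I} -> in_span s a -> a \in I.
Proof.
by move=> sI [c ->]; apply: rpred_sum => i _; apply/idealMr/sI/mem_nth.
Qed.

(** Gaussian elimination on [I] along the functionals [fs]. With the eight coordinates as [fs], the
    remainder [a - b] is zero, so [s] generates [I]. *)
Lemma finite_span_mod (I : idealr R) (fs : seq (R -> k)) :
  (forall f, List.In f fs -> forall a c b, f (a - rC c * b) = f a - c * f b) ->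
  exists2 s : seq R, {subset s <= I} & forall a, a \in I -> exists2 b,
    in_span s b & forall f, List.In f fs -> f (a - b) = 0.
Proof.
elim: fs => [|f fs IH] lin.
  by exists [::] => // a _; exists 0 => //; apply: in_span0.
have [|s sI sP] := IH; first by move=> g gfs; apply: lin; right.
(* The pivot [e] clears [f] without disturbing the other functionals; if there is none, [f] already
   vanishes on the remainders [a - b]. *)
have [[e [eI efs fe]]|none] := pselect (exists e,
  [/\ e \in I, forall g, List.In g fs -> g e = 0 & f e != 0]); last first.
  exists s => // a aI; have [b sb bP] := sP a aI; exists b => // g [<-|/bP //].
  apply: contrapT => /eqP fab; apply: none; exists (a - b); split=> //.
  by rewrite rpredB //; apply: span_sub_ideal sb.
have e_lin g : List.In g fs -> forall a c, g (a - rC c * e) = g a.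
  by move=> gfs a c; rewrite lin ?efs ?mulr0 ?subr0 //; right.
exists (e :: s) => [x|a aI]; first by rewrite inE => /orP [/eqP ->|/sI].
have [b sb bP] := sP a aI; pose c := f (a - b) / f e.
exists (rC c * e + b) => [|g].
  by apply/in_span_cons; exists (rC c); rewrite addrC addKr.
rewrite opprD addrA addrAC; case=> [<-|gfs]; last by rewrite e_lin ?bP.
by rewrite lin ?mulfVK ?subrr //; left.
Qed.

Lemma exampleR_noetherian : noetherian R.
Proof.
move=> I; pose fs : seq (R -> k) := [seq (fun r => pr (coord r)) |
  pr <- [:: @c1 k; @cw k; @cx k; @cy k; @cz k; @cwx k; @cwy k; @cxx k]].
have [|s sI sP] := finite_span_mod I (fs := fs).
  move=> f fP a c b; rewrite /fs /= in fP.
  by case: fP => [|[|[|[|[|[|[|[|[]]]]]]]]] <-;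
    rewrite coordB coordM coord_rC /= ?mul0r ?addr0 ?subr0.
exists s => a; split=> [aI|]; last first.
  exact: span_sub_ideal.
have [b sb bP] := sP a aI; suff -> : a = b by [].
have P f : List.In f fs -> f (a - b) = 0 by move/bP.
apply/subr0_eq/coord_inj; rewrite coord0.
apply: alg8P; rewrite [RHS]/=;
  match goal with |- ?h _ = _ => apply: (P (fun r => h (coord r))) end;
  by rewrite /fs /=; intuition.
Qed.

Lemma exampleR_local : local_ring R.
Proof.
split; first exact: exampleR_noetherian.
exists (rmax : idealr R); first exact: rmax_maximal.
move=> m mmax r; apply/idP/idP; first exact: proper_sub_rmax.
by apply: mmax; apply: proper_sub_rmax.
Qed.

Lemma ann_x (r : R) : rX k 1 * r = 0 -> exists s, r = rX k 2 * s.
Proof.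
move/(congr1 (@coord k)); rewrite coordM coord_rX // /alg8X inordK // coord0.
move=> E; pose a := coord r.
(* Only the coordinates on y, wx, wy and x^2 survive; the witness divides by y, using [wx = y y] and
   [x x = - y z]. *)
exists (of_coord (Alg8 (cy a) (cwy a) 0 (cwx a) (- cxx a) 0 0 0)).
apply: coord_inj; rewrite coordM of_coordK coord_rX // /alg8X inordK //.
move: E (congr1 (@cx k) E) (congr1 (@cwx k) E) (congr1 (@cwy k) E)
  (congr1 (@cxx k) E).
rewrite -/a /= !mul0r !mul1r !(add0r, addr0, oppr0) => _ a1 aw az ax.
apply: alg8P => /=; rewrite ?a1 ?aw ?az ?ax; ring.
Qed.

Lemma ann_y (r : R) : rX k 2 * r = 0 -> exists s, r = rX k 1 * s.
Proof.
move/(congr1 (@coord k)); rewrite coordM coord_rX // /alg8X inordK // coord0.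
move=> E; pose a := coord r.
(* Here the coordinates on x, wx, wy and x^2 survive, and [wy = xz] allows division by x. *)
exists (of_coord (Alg8 (cx a) (cwx a) (cxx a) 0 (cwy a) 0 0 0)).
apply: coord_inj; rewrite coordM of_coordK coord_rX // /alg8X inordK //.
move: E (congr1 (@cy k) E) (congr1 (@cwx k) E) (congr1 (@cwy k) E)
  (congr1 (@cxx k) E).
rewrite -/a /= !mul0r !mul1r !(add0r, addr0, oppr0) => _ a1 ay aw /eqP.
rewrite oppr_eq0 => /eqP az.
apply: alg8P => /=; rewrite ?a1 ?aw ?az ?ay; ring.
Qed.

End LocalExample.

(* [monalg] rebinds [mmap] and [{mpoly _[_]}], used above as in [mpoly]. *)
From mathcomp Require Import monalg.

(** * Infinite CI-dimension *)

Section Flat.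
Variables (R R' : comNzRingType) (f : {rmorphism R -> R'}).

Lemma tensor1_0 (M : lmodType R) : tensor1 f (0 : M) = 0.
Proof.
have := tensor1D f 1 (0 : M) 0; rewrite scaler0 addr0 rmorph1 scale1r.
by move/esym/eqP; rewrite -subr_eq0 addrK => /eqP.
Qed.

Lemma tensor1Z (M : lmodType R) a (m : M) :
  tensor1 f (a *: m) = f a *: tensor1 f m.
Proof. by rewrite -[a *: m]addr0 tensor1D tensor1_0 addr0. Qed.

Lemma base_change_generated (M : lmodType R) (m0 : M) :
  (forall m : M, exists c, m = c *: m0) ->
  forall t : base_change f M, exists c, t = c *: tensor1 f m0.
Proof.
move=> gen t; rewrite -(qmodK t); move: (repr _) => u.
rewrite [u]monalgE linear_sum /=.
apply: (big_ind (fun x => exists c, x = c *: tensor1 f m0)).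
- by exists 0; rewrite scale0r.
- by move=> _ _ [c ->] [c' ->]; exists (c + c'); rewrite scalerDl.
move=> m _; have [c ->] := gen m; exists (mcoeff (c *: m0) u * f c).
rewrite -scalerA -tensor1Z /tensor1 -linearZ /=; congr (qmod _ _).
by apply/malgP => x; rewrite mcoeffZ !mcoeffU mulr_natr.
Qed.

(** Flatness applied to [L -> R -> N], where 1 goes to [n]: the annihilator of [1 (x) n] is
    generated over [R'] by the image of that of [n]. The predicate [I] is any ideal containing these
    generators. *)
Lemma flat_ann (L N : lmodType R) (g : {linear L -> R^o}) (n : N)
    (I : R' -> Prop) (r : R') :
  faithfully_flat f ->
  (forall a : R, a *: n = 0 <-> exists l, g l = a) ->
  I 0 -> (forall c x y, I x -> I y -> I (c * x + y)) ->
  (forall l, I (f (g l))) ->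
  r *: tensor1 f n = 0 -> I r.
Proof.
move=> ff ann I0 Iclosed Ig rn0.
have gh l : act n (g l) = 0 by apply/ann; exists l.
have [/(_ _) ex _] := ff _ _ _ g (act n) gh.
have [|ex1 _] := ex _ (r *: tensor1 f (1 : R^o)); first by move=> a; apply: ann.
have [|t tE] := ex1.
  by rewrite linearZ /= base_change_map1 /= scale1r.
(* Its lift is the canonical map from [R' (x) R] to [R'], which turns the equation in the tensor
   product into one in [R']. *)
pose h : R^o -> R'^o := fun a => f a.
have h_lin a x y : h (a *: x + y) = f a *: h x + h y.
  by rewrite /h rmorphD rmorphM.
pose lift := mklin (base_change_lift_linear h_lin).
have rE : base_change_lift h (r *: tensor1 f (1 : R^o)) = r.
  have /= -> := linearZ_LR lift.
  by rewrite base_change_lift1 // /h rmorph1 [_ *: _]mulr1.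
rewrite -rE -tE -(qmodK t) [base_change_map _ _]base_change_lift_qmod.
  2: by move=> a x y; rewrite linearP tensor1D.
rewrite /free_lift; have /= -> := linear_sum lift.
apply: big_ind => //.
  by move=> x y Ix Iy; rewrite -[x]mul1r; apply: Iclosed.
move=> x _; have /= -> := linearZ_LR lift.
rewrite base_change_lift1 // -[_ *: _]addr0; apply: Iclosed => //; exact: Ig.
Qed.

End Flat.

(** * Freeness of J/J^2 for a regular sequence *)

Section RegularCoefficients.
Variables (Q : comNzRingType) (s : seq Q).

Lemma in_span_nat (t : seq Q) a :
  in_span t a <-> exists d : nat -> Q, a = \sum_(i < size t) d i * t`_i.
Proof.
split=> [[c ->]|[d ->]]; last by exists (fun i => d i).
exists (fun n => if insub n is Some i then c i else 0).
by apply: eq_bigr => i _; rewrite valK.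
Qed.

(** The classes of the [s_i] are independent in [J/J^2] over [Q/J]. The induction runs over prefixes
    of [s], starting from the last coefficient, which regularity puts in the ideal of the earlier
    elements. *)
Lemma regular_coef (b : nat -> Q) :
  regular_sequence s -> \sum_(i < size s) b i * s`_i = 0 ->
  forall i, (i < size s)%N -> in_span s (b i).
Proof.
case=> _ reg; suff gen n : (n <= size s)%N -> forall b : nat -> Q,
    \sum_(i < n) b i * s`_i = 0 -> forall i, (i < n)%N -> in_span s (b i).
  exact: gen.
elim: n => [|n IH] n_le {}b; first by [].
rewrite big_ord_recr /= => /eqP; rewrite addrC addr_eq0 => /eqP bE.
have size_n : size (take n s) = n by rewrite size_takel // ltnW.
have takeE c : \sum_(i < n) c i * (take n s)`_i = \sum_(i < n) c i * s`_i.
  by apply: eq_bigr => i _; rewrite nth_take.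
have bn : in_span (take n s) (b n).
  apply: reg => //; rewrite mulrC bE; apply/in_spanN/in_span_nat.
  by exists b; rewrite size_n takeE.
have [d dE] := (in_span_nat _ _).1 bn; rewrite size_n takeE in dE.
(* Substituting [b n = sum d_i s_i] leaves a relation among the first [n] elements. *)
have {}IH := IH (ltnW n_le) (fun i => b i + d i * s`_n).
move=> i; rewrite ltnS leq_eqVlt => /orP [/eqP ->|i_lt].
  by apply: in_span_sub bn => x; apply: mem_take.
rewrite -[b i](addrK (d i * s`_n)); apply: in_spanD.
  apply: IH i_lt; rewrite -[RHS](subrr (\sum_(i < n) b i * s`_i)) -bE dE.
  rewrite mulr_suml -big_split /=; apply: eq_bigr => j _.
  by rewrite mulrDl mulrAC.
by apply/in_spanN/in_spanM/mem_in_span/mem_nth.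
Qed.

End RegularCoefficients.

(** * Two colon ideals of R equal to m *)

Section Colon.
Variables (k : fieldType) (i : bool).
Local Notation R := (exampleR k).
Local Notation pr := (if i then @cw k else @cy k).

(** This is the ideal (x, y, z) if [i] is true and (w, x, z) otherwise; both contain m^2. The
    quotient of R has basis 1 and [colon_gen], so that [colon_gen] has annihilator m there. *)
Definition colon_pred : {pred R^o} :=
  fun r => (c1 (coord r) == 0) && (pr (coord r) == 0).
Fact colon_closed : submod_closed colon_pred.
Proof.
rewrite /colon_pred; split=> [|a r s]; rewrite !unfold_in.
  by rewrite coord0; case: i; rewrite /= eqxx.
rewrite coordD [_ *: _]/(a * r) coordM.
move: (coord a) (coord r) (coord s) => {}a {}r {}s.
move=> /andP [/eqP r1 /eqP ri] /andP [/eqP s1 /eqP si].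
move: ri si; case: i => /= ri si;
  by rewrite r1 s1 ri si !mulr0 !addr0 eqxx.
Qed.
HB.instance Definition _ := GRing.isSubmodClosed.Build R R^o colon_pred
  colon_closed.

Definition colon_gen : R := rX k (if i then 0 else 2).

Lemma colon_ann (a : R) :
  a *: qmod colon_pred colon_gen = 0 <->
  exists l : ideal_module (rmax (k := k) : idealr R), ideal_val l = a.
Proof.
rewrite -linearZ /= -(linear0 (qmod colon_pred)) qmod_eq subr0.
have -> : (a *: (colon_gen : R^o) \in colon_pred) = (a \in rmax (k := k)).
  rewrite !unfold_in /rmax /colon_pred [_ *: _]/(a * colon_gen) coordM.
  move: (coord a) => {}a.
  rewrite /colon_gen coord_rX; last by case: i.
  by rewrite /alg8X inordK; case: i => //=; rewrite ?mulr0 ?mulr1 ?addr0 eqxx.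
by split=> [am|[[l lm] <-]] //; exists (IdealModule am).
Qed.

End Colon.

(** For the ideal U given by [colon_pred], flatness extends [U : colon_gen = m] to [R'], so that the
    coefficient [a] lies in [m R'], hence in [m']. *)
Lemma flat_coef (k : fieldType) (i : bool) (R' : comNzRingType)
    (f : {rmorphism exampleR k -> R'}) (m' : idealr R') (a b c : R')
    (u v : exampleR k) :
  faithfully_flat f -> (forall r, r \in @rmax k -> f r \in m') ->
  (u : (exampleR k)^o) \in colon_pred i ->
  (v : (exampleR k)^o) \in colon_pred i ->
  a * f (colon_gen k i) = b * f u + c * f v -> a \in m'.
Proof.
move=> ff fm uU vU aE; pose q := qmod (@colon_pred k i).
have tE r : tensor1 f (q r) = f r *: tensor1 f (q 1).
  by rewrite -tensor1Z /q -linearZ /= [_ *: _]mulr1.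
have q0 r : r \in colon_pred i -> tensor1 f (q r) = 0.
  move=> rU; suff -> : q r = 0 by rewrite tensor1_0.
  by rewrite /q -(linear0 (qmod (@colon_pred k i))) qmod_eq subr0.
pose m_mod := ideal_module (rmax (k := k) : idealr _).
have gL : linear (fun l : m_mod => ideal_val l) by [].
apply: (flat_ann (g := mklin gL) (n := q (colon_gen k i))
  (I := fun r => r \in m')) ff _ _ _ _ _.
- exact: colon_ann.
- exact: rpred0.
- by move=> d x y xm ym; apply: rpredD => //; apply: idealMr.
- by move=> [l lm]; apply: fm.
rewrite tE scalerA aE scalerDl -!scalerA -!tE !q0 //.
by rewrite !scaler0 addr0.
Qed.

(** * Quasi-deformations of R and the module xR *)

Section InfiniteCI.
Variable k : fieldType.
Local Notation R := (exampleR k).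
Local Notation x_mod := (ideal_module (x_ideal k : idealr R)).

Lemma x_idealP (r : R) : r \in x_ideal k <-> exists a, r = a * rX k 1.
Proof.
split=> [/spanP [c ->]|[a ->]]; first by exists (c ord0); rewrite big_ord1.
by apply/spanP/in_spanM/mem_in_span; rewrite mem_head.
Qed.

Lemma rX1_in : rX k 1 \in x_ideal k.
Proof. by apply/x_idealP; exists 1; rewrite mul1r. Qed.

Definition x_mod_gen : x_mod := IdealModule rX1_in.

Lemma x_mod_generated (m : x_mod) : exists c, m = c *: x_mod_gen.
Proof.
case: m => r rx; have [a aE] := (x_idealP r).1 rx.
by exists a; apply/val_inj; rewrite /= aE.
Qed.

Lemma x_mod_ann a : a *: x_mod_gen = 0 <-> exists l, act (rX k 2 : R^o) l = a.
Proof.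
split=> [/(congr1 val)|[l <-]].
  rewrite /= [_ *: _]mulrC => /ann_x [s ->]; exists s.
  by rewrite /= [_ *: _]mulrC.
apply/val_inj; rewrite /= [_ *: _]mulrC.
have [_ _ _ [_ _ xy _]] := exampleR_relations k.
by rewrite [l *: _]mulrC mulrA xy mul0r.
Qed.

Theorem x_ideal_infinite_CI : infinite_CI_dimension x_mod.
Proof.
move=> [R' [Q [f [q [[[locR locR' locQ] loc ff q_surj [s reg kerq]] fpd]]]]].
have [_ [m' m'max _]] := locR'.
have fm r : r \in @rmax k -> f r \in m'.
  by apply: loc => //; apply: rmax_maximal.
have [ww wx wy [wz xx xy zz]] := exampleR_relations k.
have [W WE] := q_surj (f (rX k 0)); have [X XE] := q_surj (f (rX k 1)).
have [Y YE] := q_surj (f (rX k 2)); have [Z ZE] := q_surj (f (rX k 3)).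
have rel p : q p = 0 -> exists d : nat -> Q, p = \sum_(i < size s) d i * s`_i.
  by move/kerq/in_span_nat.
have [|a XY] := rel (X * Y); first by rewrite rmorphM XE YE -rmorphM xy rmorph0.
have [|d1 d1E] := rel (W * W); first by rewrite rmorphM WE -rmorphM ww rmorph0.
have [|d2 d2E] := rel (W * X - Y * Y).
  by rewrite rmorphB !rmorphM WE XE YE -!(rmorphM f) wx subrr.
have [|d4 d4E] := rel (W * Z).
  by rewrite rmorphM WE ZE -rmorphM wz rmorph0.
have [|d5 d5E] := rel (X * X + Y * Z).
  by rewrite rmorphD !rmorphM XE YE ZE -!(rmorphM f) xx rmorphN addNr.
have qs (b : nat -> Q) i : (i < size s)%N -> \sum_(j < size s) b j * s`_j = 0 ->
    q (b i) = 0.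
  by move=> i_lt /(regular_coef reg) /(_ i i_lt) /kerq.
(* The syzygy [Z (W^2) = W (WZ)], read on coefficients modulo [J], is [d4_i w = d1_i z] in [R'],
   where z lies in (x, y, z). *)
have d4m (i : 'I_(size s)) : q (d4 i) \in m'.
  apply: (@flat_coef k true R' f m' _ (q (d1 i)) 0 (rX k 3) 0) => //.
  - rewrite unfold_in /colon_pred coord_rX // /alg8X inordK //=.
    by rewrite eqxx.
  - by rewrite unfold_in /colon_pred coord0 /= eqxx.
  rewrite mul0r addr0 -WE -ZE -!(rmorphM q); apply/subr0_eq; rewrite -rmorphB.
  apply: (qs (fun j => d4 j * W - d1 j * Z)) => //.
  rewrite [RHS](_ : 0 = (W * Z) * W - (W * W) * Z); last by ring.
  rewrite d4E d1E !mulr_suml -sumrB; apply: eq_bigr => j _; ring.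
(* The second syzygy gives [(a_i + d4_i) y = d5_i w - d2_i x] in [R'], with w and x in (w, x, z);
   then [d4m] removes [d4_i]. *)
have am (i : 'I_(size s)) : q (a i) \in m'.
  rewrite -[q (a i)](addrK (q (d4 i))); apply: rpredB => //.
  apply: (@flat_coef k false R' f m' _ (q (d5 i)) (- q (d2 i))
    (rX k 0) (rX k 1)) => //.
  - rewrite unfold_in /colon_pred coord_rX // /alg8X inordK //=.
    by rewrite eqxx.
  - rewrite unfold_in /colon_pred coord_rX // /alg8X inordK //=.
    by rewrite eqxx.
  rewrite -WE -XE -YE mulNr -rmorphD -!(rmorphM q) -rmorphB; apply/subr0_eq.
  rewrite -rmorphB.
  apply: (qs (fun j => (a j + d4 j) * Y - (d5 j * W - d2 j * X))) => //.
  rewrite [RHS](_ : 0 = (X * Y) * Y + (W * Z) * Y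
    - ((X * X + Y * Z) * W - (W * X - Y * Y) * X)); last by ring.
  rewrite XY d4E d5E d2E !mulr_suml -big_split -!sumrB /=.
  by apply: eq_bigr => j _; ring.
(* The test module is the residue field of [R'], viewed over [Q]. *)
pose V := restr_scalars q (quot_module (ideal_pred m')).
pose v : V := qmod (ideal_pred m') 1.
have v0 : v != 0.
  apply/eqP; rewrite /v -[0](linear0 (qmod (ideal_pred m'))) => /qmod_eq.
  by rewrite subr0 unfold_in /= idealr1.
have killed c (u : V) : q c \in m' -> c *: u = 0.
  move=> cm; rewrite -[u](qmodK (u : quot_module (ideal_pred m'))).
  rewrite -[LHS]/(q c *: qmod (ideal_pred m') _) -linearZ /=.
  rewrite -[RHS](linear0 (qmod (ideal_pred m'))); apply/qmod_eq.
  by rewrite subr0 unfold_in [_ *: _]mulrC idealMr.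
have fX i : (i < 4)%N -> f (rX k i) \in m'.
  move=> i4; apply: fm; rewrite unfold_in /rmax coord_rX // /alg8X inordK //.
  by case: i i4 => [|[|[|[|i]]]] //=; rewrite eqxx.
(* By flatness, the annihilators of x and y keep their generators y and x in [R' = Q/J]. *)
have ann_q (i j : nat) (P P' : Q) : q P = f (rX k i) -> q P' = f (rX k j) ->
    (forall r : R, rX k i * r = 0 -> exists t, r = rX k j * t) ->
    rX k i * rX k j = 0 ->
    forall c, in_span s (P * c) -> exists u, in_span s (c - P' * u).
  move=> PE P'E ann ij c /kerq; rewrite rmorphM PE => Pc.
  have [u uE] : exists u, q c = f (rX k j) * u.
    apply: (@flat_ann _ _ f _ _ (act (rX k j : R^o)) (rX k i : R^o)
      (fun r => exists u, r = f (rX k j) * u)) => //.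
    - move=> r; split=> [|[l <-]]; last first.
        by rewrite /= [LHS]mulrC [_ *: _]mulrC mulrA ij mul0r.
      by rewrite [_ *: _]mulrC => /ann [t ->]; exists t; rewrite /= [LHS]mulrC.
    - by exists 0; rewrite mulr0.
    - move=> e _ _ [t ->] [t' ->]; exists (e * t + t').
      by rewrite mulrDr mulrCA.
    - by move=> l; exists (f l); rewrite /= -rmorphM mulrC.
    have -> : tensor1 f (rX k i : R^o) = f (rX k i) *: tensor1 f (1 : R^o).
      by rewrite -tensor1Z [_ *: _]mulr1.
    by rewrite scalerA mulrC Pc scale0r.
  have [u' u'E] := q_surj u; exists u'; apply/kerq.
  by rewrite rmorphB rmorphM u'E P'E uE subrr.
have yx : rX k 2 * rX k 1 = 0 by rewrite mulrC.
pose m0 : restr_scalars q (base_change f x_mod) := tensor1 f x_mod_gen.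
apply: (infinite_projective_dimension (m0 := m0) (v := v) (X := X) (Y := Y)
  (a := fun i => a i) reg XY) fpd => //.
- exact: ann_q YE XE (@ann_y k) yx.
- exact: ann_q XE YE (@ann_x k) xy.
- move=> m; have [c cE] := base_change_generated x_mod_generated m.
  have [c' c'E] := q_surj c; exists c'; apply: etrans cE _.
  exact: (congr1 (fun r => r *: tensor1 f x_mod_gen) (esym c'E)).
- move=> c; split=> [c0|[u /kerq cE]]; last first.
    have -> : c *: m0 = q c *: tensor1 f x_mod_gen by [].
    move/eqP: cE; rewrite rmorphB subr_eq0 => /eqP ->.
    rewrite rmorphM YE mulrC -scalerA -tensor1Z.
    suff -> : rX k 2 *: x_mod_gen = 0 by rewrite tensor1_0 scaler0.
    by apply/x_mod_ann; exists 1; rewrite /= scale1r.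
  have [u uE] : exists u, q c = f (rX k 2) * u.
    apply: (@flat_ann _ _ f _ _ (act (rX k 2 : R^o)) x_mod_gen
      (fun r => exists u, r = f (rX k 2) * u)) => //.
    - exact: x_mod_ann.
    - by exists 0; rewrite mulr0.
    - move=> e _ _ [t ->] [t' ->]; exists (e * t + t').
      by rewrite mulrDr mulrCA.
    - by move=> l; exists (f l); rewrite /= -rmorphM mulrC.
  have [u' u'E] := q_surj u; exists u'; apply/kerq.
  by rewrite rmorphB rmorphM u'E YE uE subrr.
move=> u; split; try by apply: killed; rewrite ?XE ?YE; apply: fX.
- move=> b /mem_in_span /kerq bE; apply: killed; rewrite bE; exact: rpred0.
- by move=> i; apply: killed.
Qed.

End InfiniteCI.

(** * The ideal xR is quasi-complete intersection *)

Lemma injective_surjective_bijective (A B : Type) (f : A -> B) :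
  injective f -> (forall b, exists a, f a = b) -> bijective f.
Proof.
move=> f_inj f_surj; exists (fun b => projT1 (cid (f_surj b))) => [a|b].
  by apply: f_inj; case: cid.
by case: cid.
Qed.

Section ExteriorLift.
Variables (S : comNzRingType) (M : lmodType S) (H : lalgType S)
  (phi : {linear M -> H}).
(** An [lalgType] relates scalars to left factors only, so their centrality is a separate
    condition. *)
Hypothesis H_central : forall (c : S) (x : H), x * c%:A = c *: x.
Hypothesis phi_sqr : forall m, phi m * phi m = 0.

Definition ext_word (w : {fmonom M}) : H := \prod_(m <- w) phi m.

Fact ext_word_mmorphism : mmorphism ext_word.
Proof.
split=> [u v|]; last by rewrite /ext_word fm1 big_nil.
by rewrite /ext_word [mmul u v]fmmulE big_cat.
Qed.
HB.instance Definition _ :=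
  monalg.isMultiplicative.Build _ H ext_word ext_word_mmorphism.

Local Notation F := (mmap (in_alg H) ext_word).

Lemma ext_free_mul : {morph F : x y / x * y}.
Proof.
apply: (commr_mmap_is_multiplicative _).1 => g m m'.
by rewrite /GRing.comm H_central mulr_algl.
Qed.

Lemma ext_free_var m : F (ext_var m) = phi m.
Proof. by rewrite mmapU /= scale1r mul1r /ext_word fmuE big_seq1. Qed.

Lemma ext_free_ideal u : u \in ext_ideal M -> F u = 0.
Proof.
move/span2P; elim=> {u} [|a b u v ru _ IH]; first exact: mmap0.
rewrite mmapD IH addr0 !ext_free_mul.
suff -> : F u = 0 by rewrite mulr0 mul0r.
case: ru => [c m n|m].
  by rewrite mmapB mmapD mmapZ !ext_free_var linearP mulr_algl subrr.
by rewrite ext_free_mul ext_free_var phi_sqr.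
Qed.

Definition ext_lift_fun (u : exterior_algebra M) : H := F (qrepr u).

Lemma ext_lift_qring u : ext_lift_fun (qring (ext_ideal M) u) = F u.
Proof.
apply/subr0_eq; rewrite /ext_lift_fun -mmapB; apply: ext_free_ideal.
exact/qring_eq/qringK.
Qed.

Fact ext_lift_linear : linear ext_lift_fun.
Proof.
move=> a u v; rewrite -[u]qringK -[v]qringK.
move: (qrepr u) (qrepr v) => {}u {}v.
have -> : a *: (qring (ext_ideal M) u : exterior_algebra M)
    + (qring (ext_ideal M) v : exterior_algebra M)
    = qring (ext_ideal M) (a *: u + v).
  rewrite [RHS](raddfD (qring (ext_ideal M))).
  exact: (congr1 (fun t => t + _) (ext_scaleE a u)).
by rewrite !ext_lift_qring mmapD mmapZ mulr_algl.
Qed.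

Fact ext_lift_monoid : monoid_morphism ext_lift_fun.
Proof.
split=> [|u v].
  by rewrite [1](rmorph1 (qring (ext_ideal M))) ext_lift_qring mmap1.
rewrite -[u]qringK -[v]qringK -rmorphM !ext_lift_qring.
exact: ext_free_mul.
Qed.

(** The universal property of the exterior algebra: the extension of [phi] to the free algebra kills
    the defining relations. *)
Definition ext_lift : {lrmorphism exterior_algebra M -> H} :=
  HB.pack ext_lift_fun
    (GRing.isLinear.Build S (exterior_algebra M) H *:%R _ ext_lift_linear)
    (GRing.isMonoidMorphism.Build (exterior_algebra M) H _ ext_lift_monoid).

Lemma ext_lift_gen m : ext_lift (ext_gen m) = phi m.
Proof. by rewrite /= ext_lift_qring ext_free_var. Qed.

End ExteriorLift.

(** * Algebras spanned by 1 and a square-zero element *)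

Lemma scale_malgU (S : comNzRingType) (K : choiceType) (a : S) (w : K) :
  a *: << w >> = << a *g w >>.
Proof.
by apply/malgP => w'; rewrite mcoeffZ !mcoeffU mulrnAr mulr1.
Qed.

Lemma lin2_closed (S : comNzRingType) (V : lmodType S) (x y : V) :
  let P v := exists a b, v = a *: x + b *: y in
  [/\ P 0, forall v v', P v -> P v' -> P (v + v')
    & forall c v, P v -> P (c *: v)].
Proof.
move=> P; split=> [|_ _ [a [b ->]] [a' [b' ->]]|c _ [a [b ->]]].
- by exists 0, 0; rewrite !scale0r addr0.
- by exists (a + a'), (b + b'); rewrite !scalerDl addrACA.
- by exists (c * a), (c * b); rewrite scalerDr !scalerA.
Qed.

Lemma ext_gen_mulC (S : comNzRingType) (M : lmodType S) (m : M) (a : S) :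
  ext_gen m * a%:A = a *: ext_gen m.
Proof.
have -> : a%:A = qring (ext_ideal M) (a *: 1) :> exterior_algebra M.
  exact: ext_scaleE.
have -> : a *: ext_gen m = qring (ext_ideal M) (a *: ext_var m).
  exact: ext_scaleE.
rewrite -[LHS]rmorphM; congr qring.
rewrite [a *: 1]scale_malgU [a *: _]scale_malgU.
by rewrite [LHS]fgmulUU mul1r mulm1.
Qed.

Lemma ext_genZ (S : comNzRingType) (M : lmodType S) (a : S) (m : M) :
  ext_gen (a *: m) = a *: ext_gen m.
Proof. exact: (linearZ_LR (mklin (@ext_gen_linear S M))). Qed.

Lemma square_zero_mul (S : comNzRingType) (A : lalgType S) (g : A) (a b c : S) :
  g * g = 0 -> (forall r : S, g * r%:A = r *: g) ->
  (c *: g) * (a%:A + b *: g) = (c * a) *: g.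
Proof.
move=> gg gC; rewrite -scalerAl mulrDr gC -[b *: g]mulr_algl mulrA gC.
by rewrite -scalerAl gg scaler0 addr0 scalerA.
Qed.

(** By induction on words: prefixing a letter [c *: e] sends [a + b e] to [(c a) e], since [e]
    squares to zero. *)
Lemma ext_cyclic (S : comNzRingType) (M : lmodType S) (e : M) :
  (forall m : M, exists c, m = c *: e) ->
  forall u : exterior_algebra M, exists a b, u = a%:A + b *: ext_gen e.
Proof.
move=> gen u; rewrite -[u]qringK; move: (qrepr u) => {}u.
pose P (u : exterior_algebra M) := exists a b, u = a%:A + b *: ext_gen e.
have [P0 PD PZ] := lin2_closed (1 : exterior_algebra M) (ext_gen e).
have PW w c :
    P (qring (ext_ideal M) << w >>) -> P (qring (ext_ideal M) << c *g w >>).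
  move/(PZ c); suff -> : c *: (qring (ext_ideal M) << w >> : exterior_algebra M)
    = qring (ext_ideal M) << c *g w >> by [].
  by rewrite -(scale_malgU c); exact: ext_scaleE.
rewrite -/(P _) [u]monalgE raddf_sum; apply: big_ind => // w _; apply: PW.
case: w => w; elim: w => [|m w IH].
  exists 1, 0; rewrite scale1r scale0r addr0.
  by rewrite -[RHS](rmorph1 (qring (ext_ideal M))) -fmoneE.
have -> : << FMonom (m :: w) >> =
    ext_var m * << FMonom w >> :> {malg S[{fmonom M}]}.
  by rewrite [RHS]fgmulUU mulr1 [mmul (fmu m) _]fmmulE fmuE.
case: IH => a [b IH]; have [c ->] := gen m.
have -> : qring (ext_ideal M) (ext_var (c *: e) * << FMonom w >>)
    = ext_gen (c *: e) * (a%:A + b *: ext_gen e) :> exterior_algebra M.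
  by rewrite -IH; exact: (rmorphM (qring (ext_ideal M))).
rewrite ext_genZ square_zero_mul.
- by exists 0, (c * a); rewrite scale0r add0r.
- exact: ext_gen_sqr.
- exact: ext_gen_mulC.
Qed.

(** Independence of 1 and [L g] gives injectivity without knowing that 1 and [g] are independent in
    [A]. *)
Lemma affine_bijective (S : comNzRingType) (A B : lalgType S)
    (L : {lrmorphism A -> B}) (g : A) :
  (forall u, exists a b, u = a%:A + b *: g) ->
  (forall h, exists a b, h = a%:A + b *: L g) ->
  (forall a b, a%:A + b *: L g = 0 -> a = 0 /\ b = 0) ->
  bijective L.
Proof.
move=> genA genB free.
have LE a b : L (a%:A + b *: g) = a%:A + b *: L g.
  by rewrite linearD !linearZ_LR rmorph1.
apply: injective_surjective_bijective => [u v uv|h]; last first.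
  by have [a [b ->]] := genB h; exists (a%:A + b *: g).
apply/subr0_eq; have [a [b abE]] := genA (u - v).
have Luv : L (u - v) = 0.
  by rewrite raddfB; apply/eqP; rewrite subr_eq0; apply/eqP.
have [a0 b0] : a = 0 /\ b = 0 by apply: free; rewrite -LE -abE.
by rewrite abE a0 b0 !scale0r addr0.
Qed.

(** * The Koszul homology of x *)

Section QuasiCompleteIntersection.
Variable k : fieldType.
Local Notation R := (exampleR k).
Local Notation x := (rX k 1).
Local Notation y := (rX k 2).
Local Notation I := (x_ideal k : idealr R).
Local Notation S := {ideal_quot I}.
Local Notation E := (koszul [:: x]).

Lemma x_generates : generates [:: x] I.
Proof. by move=> a; split=> /spanP. Qed.

Local Notation H := (koszul_homology x_generates).

Lemma d_koszul1 (u v : R) : dga_d ((u, v) : E) = (x * v, 0).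
Proof. by apply: pair_ext; rewrite /= ?oppr0 // add0r. Qed.

Fact ycycle_subproof : ((0, y) : E) \in @cycle_pred R E.
Proof.
have [_ _ _ [_ _ xy _]] := exampleR_relations k.
by rewrite unfold_in d_koszul1 xy.
Qed.
Definition ycycle : cycles E := Cycle ycycle_subproof.
Local Notation eta := (hclass x_generates ycycle).

(** A pair [(u, v)] is a cycle exactly when [x v = 0], that is, when [v] is a multiple of y. *)
Lemma cycle_decomposition (z : cycles E) :
  exists u t : R, z = u *: 1 + t *: ycycle.
Proof.
case: z => [[u v] uv]; have /ann_x [t vE] : x * v = 0.
  by move: uv; rewrite unfold_in d_koszul1 => /eqP [].
exists u, t; apply/val_inj/pair_ext => /=.
  by rewrite scaler0 addr0 [_ *: _]mulr1.
by rewrite scaler0 add0r vE [_ *: _]mulrC.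
Qed.

Lemma homology_decomposition (h : H) : exists a b : S, h = a%:A + b *: eta.
Proof.
rewrite -(hclassK h); have [u [t ->]] := cycle_decomposition (qrepr h).
exists (\pi_S u), (\pi_S t).
by rewrite hclassD -!hclassZ.
Qed.

(** Boundaries have the form [(x q, 0)]. So a lift of [a] lies in xR, and a lift of [b] kills y,
    hence lies in [ann y = xR] as well. *)
Lemma homology_free (a b : S) : a%:A + b *: eta = 0 :> H -> a = 0 /\ b = 0.
Proof.
rewrite -[a]reprK -[b]reprK; move: (repr a) (repr b) => {}a {}b.
have -> : (1 : H) = hclass x_generates 1 by [].
rewrite !hclassZ -hclassD; have -> : (0 : H) = hclass x_generates 0.
  by rewrite [RHS](raddf0 (qring (boundary_ideal x_generates))).
move/hclass_eq; rewrite subr0 => /boundariesP [[p q]].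
rewrite d_koszul1 /= => /pair_equal_spec [/= E1 E2].
have piE (r : R) : r \in x_ideal k -> \pi_S r = 0.
  move=> rI; rewrite -(rmorph0 \pi_S); apply/eqP.
  by rewrite -Quotient.idealrBE subr0.
split; apply: piE; apply/x_idealP.
  exists q; move: E1; rewrite scaler0 addr0 [_ *: _]mulr1 => <-.
  by rewrite mulrC.
have [|s ->] := @ann_y k b; last by exists s; rewrite mulrC.
by move: E2; rewrite scaler0 add0r [_ *: _]mulrC => <-.
Qed.

Lemma eta_sqr : eta * eta = 0.
Proof.
rewrite -hclassM -[RHS](raddf0 (qring (boundary_ideal x_generates))).
congr hclass; apply/val_inj/pair_ext; rewrite /= ?mulr0 ?mul0r //.
by rewrite addr0.
Qed.

Lemma homology_central (c : S) (h : H) : h * c%:A = c *: h.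
Proof.
rewrite -(hclassK h) -[c]reprK; move: (repr c) (qrepr h) => {}c {}h.
have -> : (1 : H) = hclass x_generates 1 by [].
rewrite !hclassZ -hclassM; congr hclass; apply/val_inj.
by rewrite /= -scalerAr mulr1.
Qed.

Lemma eta_deg : eta \in @hdeg _ _ _ x_generates 1.
Proof.
apply/asboolP; exists ycycle => //.
by split; [right | left].
Qed.
Definition eta1 : homology_deg x_generates 1 := HomologyDeg eta_deg.

Lemma homology1_generated (h : homology_deg x_generates 1) :
  exists c, h = c *: eta1.
Proof.
case: h => h hP; have /asboolP [z zd hE] := hP.
have [u [t zE]] := cycle_decomposition z.
exists (\pi_S t); apply/val_inj; rewrite /= hE hclassZ; congr hclass.
(* Degree 1 forces the first component of the pair, here [u], to vanish. *)
have u0 : u = 0.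
  case: zd => /= - [//|]; rewrite zE /= scaler0 addr0 [_ *: _]mulr1.
  by [].
by rewrite zE u0 scale0r add0r.
Qed.

Lemma homology1_free : free_module (homology_deg x_generates 1).
Proof.
exists unit, (free_lift (fun _ => eta1)).
have fE (g : {malg S[unit]}) :
    free_lift (fun _ => eta1) g = mcoeff tt g *: eta1.
  rewrite (@free_liftEw _ _ _ _ [fset tt]%fset); first by rewrite big_seq_fset1.
  by apply/fsubsetP => -[] _; rewrite in_fset1.
apply: injective_surjective_bijective => [g g'|h].
  move=> gg'E; have := etrans (esym (fE g)) (etrans gg'E (fE g')).
  move/eqP; rewrite -subr_eq0 -scalerBl => /eqP /(congr1 val) /= gg'0.
  have [|_ /subr0_eq gg'] := @homology_free 0 (mcoeff tt g - mcoeff tt g').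
    by rewrite scale0r add0r.
  by apply/malgP => -[].
have [c ->] := homology1_generated h; exists << c *g tt >>.
by apply: etrans (fE _) _; rewrite mcoeffUU.
Qed.

Fact homology_val_linear : linear (@homology_val _ _ _ x_generates 1).
Proof. by []. Qed.

Theorem x_ideal_qci : quasi_complete_intersection I.
Proof.
split; first exact: exampleR_local.
exists [:: x], x_generates; split; first exact: homology1_free.
pose phi := mklin homology_val_linear.
have sqr m : phi m * phi m = 0.
  have [c ->] := homology1_generated m.
  have -> : phi (c *: eta1) = c *: eta by [].
  rewrite -scalerAl -[c *: eta]mulr_algl mulrA homology_central -scalerAl.
  by rewrite eta_sqr !scaler0.
exists (ext_lift homology_central sqr).
have genE m : ext_lift homology_central sqr (ext_gen m) = homology_val m.
  exact: ext_lift_gen.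
split=> //; apply: (affine_bijective (g := ext_gen eta1)).
- exact: ext_cyclic homology1_generated.
- by rewrite genE; exact: homology_decomposition.
- by rewrite genE; exact: homology_free.
Qed.

End QuasiCompleteIntersection.

Theorem theorem3p5 (k : fieldType) (char_k : 2%N \notin [pchar k]) :
  quasi_complete_intersection (x_ideal k : idealr (exampleR k)) /\
  infinite_CI_dimension (ideal_module (x_ideal k : idealr (exampleR k))).
Proof. by split; [exact: x_ideal_qci | exact: x_ideal_infinite_CI]. Qed.
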